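(* Let $d\ge1$, $n\ge0$, and let $\mathcal{T}$ be a triangulation of $C(n+2d+1,2d)$. A $d$-arc of $\mathcal{T}$ is mutable if and only if it is not in the middle of a maximal retrograde path in $Q(\mathcal{T})$.
   Context: Write $N=n+2d+1$. The cyclic polytope $C(N,2d)$ is the convex hull of $N$ points $p_{t_1},\dots,p_{t_N}$ with $t_1<\dots<t_N$ on the moment curve $p_t=(t,t^2,\dots,t^{2d})$ in $\mathbb{R}^{2d}$; its vertices are labelled by $[N]$. A triangulation $\mathcal{T}$ is a collection of $(2d+1)$-subsets of $[N]$ whose convex hulls have pairwise disjoint interiors and union $C(N,2d)$. A $d$-arc of $\mathcal{T}$ is a $(d+1)$-subset of $[N]$ that is a face of some $2d$-simplex of $\mathcal{T}$ and is not contained in a facet of $C(N,2d)$. The $d$-simplices not contained in a facet are exactly the tuples $(a_0,\dots,a_d)\in[N]^{d+1}$ with $a_{i+1}\ge a_i+2$ for $0\le i\le d-1$ and $a_d+2\le a_0+N$. A triangulation is determined by its set of $d$-arcs. Arithmetic on labels is modulo $N$ with representatives $[N]$; a $d$-simplex is written $(a_0,\dots,a_d)$ in increasing order up to cyclic shift, indices of entries are taken modulo $d+1$, and inequalities between labels refer to a suitable cyclically shifted order. Two $d$-simplices $A,B$ are intertwining if, for suitable cyclic indexing, $a_0<b_0<a_1<b_1<\dots<a_d<b_d$ in some cyclically shifted order $l<l+1<\dots<N<1<\dots<l-1$ on $[N]$. Let $A-\mathbf{1}=(a_0-1,\dots,a_d-1)$. The quiver $Q(\mathcal{T})$ has as vertices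 the $d$-arcs of $\mathcal{T}$, and an arrow $A\to B$ for $A\neq B$ whenever $A-\mathbf 1$ and $B$ are intertwining and there is no $d$-arc $A'\notin\{A,B\}$ of $\mathcal{T}$ such that $A-\mathbf 1$, $A'$ are intertwining and $A'-\mathbf 1$, $B$ are intertwining. Every arrow has the form $A\to A+rE_i$, where $r\ge1$, $A+rE_i$ is $A$ with $a_i$ replaced by $a_i+r$, and $a_i<a_i+r<a_{i+1}$ cyclically. A path $A\to A+rE_i\to A+rE_i+sE_{i-1}$ in $Q(\mathcal{T})$ is retrograde at $A+rE_i$ if $a_{i-1}<a_{i-1}+s<a_i$ (cyclically). A path $A_0\to A_1\to\dots\to A_l\to A_{l+1}$ is retrograde if $A_{k-1}\to A_k\to A_{k+1}$ is retrograde at $A_k$ for all $1\le k\le l$; the vertices $A_1,\dots,A_l$ are said to be in the middle of it. Single arrows are trivially retrograde paths. A retrograde path is maximal if it is not contained in a longer retrograde path. Two triangulations of $C(N,2d)$ are bistellar flips of each other if and only if their sets of $d$-arcs have all but one element in common. A $d$-arc $A$ of $\mathcal{T}$ is mutable if there is a bistellar flip $\mathcal{T}'$ of $\mathcal{T}$ and a $d$-arc $B \neq A$ of $\mathcal{T}'$ such that the $d$-arcs of $\mathcal{T}$ other than $A$ are exactly the $d$-arcs of $\mathcal{T}'$ other than $B$. *)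

(* Defs.v *)
From HB Require Import structures.
From mathcomp Require Import all_boot all_order all_algebra.
From mathcomp Require Import all_classical all_reals all_analysis.

Set Implicit Arguments.
Unset Strict Implicit.
Unset Printing Implicit Defensive.

Import Order.TTheory GRing.Theory Num.Theory numFieldNormedType.Exports.

Local Open Scope ring_scope.

(** Labels are 0-based: the label k of [N] = {1, ..., N} is the ordinal k - 1
    of 'I_N.  Label arithmetic modulo N is iterated [ordS] / [ord_pred]. *)

(** ** Cyclic polytopes and their triangulations *)

Definition moment_point (R : realType) (d : nat) (x : R) : 'rV[R]_(2 * d) :=
  \row_(j < 2 * d) x ^+ j.+1.

Definition hull (R : realType) (d N : nat) (t : 'I_N -> R) (S : {set 'I_N}) :
    set 'rV[R]_(2 * d) :=
  fun x => exists w : 'I_N -> R,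
    [/\ forall i, 0 <= w i,
        forall i, i \notin S -> w i = 0,
        \sum_i w i = 1 &
        x = \sum_i w i *: moment_point d (t i)].
Arguments hull {R} d {N} t S.

Definition cyclic_polytope (R : realType) (d N : nat) (t : 'I_N -> R) :
    set 'rV[R]_(2 * d) :=
  hull d t [set: 'I_N]%SET.
Arguments cyclic_polytope {R} d {N} t.

Definition triangulation (R : realType) (d N : nat) (t : 'I_N -> R)
    (T : {set {set 'I_N}}) : Prop :=
  [/\ forall S, S \in T -> #|S| = (2 * d).+1,
      forall S S', S \in T -> S' \in T -> S != S' ->
        (interior (hull d t S) `&` interior (hull d t S') = set0)%classic &
      forall x, cyclic_polytope d t x <-> exists2 S, S \in T & hull d t S x].

(** Faces cut out by a valid linear inequality; this includes the polytope
    itself and the empty set. *)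
Definition polytope_face (R : realType) (m : nat) (P F : set 'rV[R]_m) : Prop :=
  exists (c : 'rV[R]_m) (b : R),
    (forall x, P x -> \sum_j c 0 j * x 0 j <= b) /\
    (forall x, F x <-> P x /\ \sum_j c 0 j * x 0 j = b).

(** Facets are the maximal proper faces. *)
Definition polytope_facet (R : realType) (m : nat) (P F : set 'rV[R]_m) : Prop :=
  [/\ polytope_face P F, F <> P &
      forall G, polytope_face P G -> G <> P -> (F `<=` G)%classic -> G = F].

Definition d_arc (R : realType) (d N : nat) (t : 'I_N -> R)
    (T : {set {set 'I_N}}) (A : {set 'I_N}) : Prop :=
  [/\ #|A| = d.+1,
      exists2 S, S \in T & A \subset S &
      ~ exists F, polytope_facet (cyclic_polytope d t) F /\
                  (hull d t A `<=` F)%classic].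

Definition d_arcs (R : realType) (d N : nat) (t : 'I_N -> R)
    (T : {set {set 'I_N}}) : {set {set 'I_N}} :=
  [set A : {set 'I_N} | `[< d_arc d t T A >]]%SET.

(** ** Bistellar flips and mutability *)

(** Flips are defined through the d-arcs: the two sets of d-arcs have all but
    one element in common. *)
Definition bistellar_flip (R : realType) (d N : nat) (t : 'I_N -> R)
    (T T' : {set {set 'I_N}}) : Prop :=
  [/\ triangulation d t T, triangulation d t T',
      #|d_arcs d t T :\: d_arcs d t T'| = 1%N &
      #|d_arcs d t T' :\: d_arcs d t T| = 1%N].

Definition mutable (R : realType) (d N : nat) (t : 'I_N -> R)
    (T : {set {set 'I_N}}) (A : {set 'I_N}) : Prop :=
  exists (T' : {set {set 'I_N}}) (B : {set 'I_N}),
    [/\ bistellar_flip d t T T', B \in d_arcs d t T', B != A &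
        (d_arcs d t T :\ A = d_arcs d t T' :\ B)%SET].

(** ** Cyclic order and intertwining *)

(** x < y in the shifted order l < l + 1 < ... < N < 1 < ... < l - 1. *)
Definition shift_lt (N : nat) (l x y : 'I_N) : bool :=
  ((x + (N - l)) %% N < (y + (N - l)) %% N)%N.

Definition cyclic_lt3 (N : nat) (x y z : 'I_N) : Prop :=
  exists l : 'I_N, shift_lt l x y && shift_lt l y z.

(** a is the tuple (a_0, ..., a_d) of the elements of A, in increasing order
    up to cyclic shift. *)
Definition cyclic_enum (d N : nat) (A : {set 'I_N}) (a : 'I_d.+1 -> 'I_N) : Prop :=
  A = [set a i | i : 'I_d.+1]%SET /\
  exists l : 'I_N, forall i j : 'I_d.+1, (i < j)%N -> shift_lt l (a i) (a j).

Definition intertwining (d N : nat) (A B : {set 'I_N}) : Prop :=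
  exists (l : 'I_N) (a b : 'I_d.+1 -> 'I_N),
    [/\ A = [set a i | i : 'I_d.+1]%SET,
        B = [set b i | i : 'I_d.+1]%SET,
        forall i, shift_lt l (a i) (b i) &
        forall i j : 'I_d.+1, j = i.+1 :> nat -> shift_lt l (b i) (a j)].

Definition minus_one (N : nat) (A : {set 'I_N}) : {set 'I_N} :=
  [set ord_pred a | a in A]%SET.

(** ** The quiver and its retrograde paths

    The quiver depends on the triangulation only through its vertex set V, the
    set of d-arcs. *)

Definition quiver_arrow (d N : nat) (V : {set {set 'I_N}}) (A B : {set 'I_N}) : Prop :=
  [/\ A \in V, B \in V, A != B,
      intertwining d (minus_one A) B &
      ~ exists A' : {set 'I_N},
          [/\ A' \in V, A' != A, A' != B,
              intertwining d (minus_one A) A' &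
              intertwining d (minus_one A') B]].

(** a + r E_i *)
Definition add_entry (d N : nat) (a : 'I_d.+1 -> 'I_N) (i : 'I_d.+1) (r : nat) :
    'I_d.+1 -> 'I_N :=
  fun j => if j == i then iter r (@ordS N) (a j) else a j.

(** A -> B -> C is of the form A -> A + r E_i -> A + r E_i + s E_(i-1) with
    a_(i-1) < a_(i-1) + s < a_i.  Indices are modulo d + 1. *)
Definition retrograde_at (d N : nat) (A B C : {set 'I_N}) : Prop :=
  exists (a : 'I_d.+1 -> 'I_N) (i : 'I_d.+1) (r s : nat),
    [/\ cyclic_enum A a,
        [/\ (1 <= r)%N, cyclic_lt3 (a i) (iter r (@ordS N) (a i)) (a (ordS i)) &
            B = [set add_entry a i r j | j : 'I_d.+1]%SET],
        (1 <= s)%N /\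
        C = [set add_entry (add_entry a i r) (ord_pred i) s j | j : 'I_d.+1]%SET &
        cyclic_lt3 (a (ord_pred i)) (iter s (@ordS N) (a (ord_pred i))) (a i)].

(** A path is the list of its vertices A_0, ..., A_(l+1), with l >= 0. *)
Definition retrograde_path (d N : nat) (V : {set {set 'I_N}})
    (p : seq {set 'I_N}) : Prop :=
  [/\ (2 <= size p)%N,
      forall k, (k.+1 < size p)%N ->
        quiver_arrow d V (nth finset.set0 p k) (nth finset.set0 p k.+1) &
      forall k, (k.+2 < size p)%N ->
        retrograde_at d (nth finset.set0 p k) (nth finset.set0 p k.+1)
          (nth finset.set0 p k.+2)].

Definition maximal_retrograde_path (d N : nat) (V : {set {set 'I_N}})
    (p : seq {set 'I_N}) : Prop :=
  retrograde_path d V p /\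
  ~ exists q, [/\ retrograde_path d V q, infix p q & (size p < size q)%N].

Definition in_middle (N : nat) (A : {set 'I_N}) (p : seq {set 'I_N}) : Prop :=
  exists k, [/\ (0 < k)%N, (k.+1 < size p)%N & nth finset.set0 p k = A].

(* Main.v *)
Require Import Defs.
From HB Require Import structures.
From mathcomp Require Import all_boot all_order all_algebra.
From mathcomp Require Import all_classical all_reals all_analysis.
From mathcomp Require Import zify ring lra.

Set Implicit Arguments.
Unset Strict Implicit.
Unset Printing Implicit Defensive.

Import Order.TTheory GRing.Theory Num.Theory numFieldNormedType.Exports.
Import fintype mathcomp.boot.finset.
Local Open Scope set_scope.

(** Everything rests on the fact that the affine dependencies between points
    of the moment curve are visible to polynomials of degree at most [2 * d].
    With [d.+1] prescribed zeros, such a polynomial can still have double zeros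
    at all of them but two cyclically consecutive ones, so that it changes sign
    exactly across one gap of the prescribed set ([between_poly]). Two
    consequences follow. A dependency whose positive part lives on [d.+1]
    points [X] is negative somewhere in each gap of [X] ([dep_cross]), and two
    intertwining sets carry a circuit, positive on one and negative on the
    other ([circuit_signs], [circuit_exists]).

    Hence the d-arcs of a triangulation never cross: near the common point of
    two crossing faces the interiors of their simplices would overlap
    ([noncrossing]). They are also complete: a d-simplex that lies in no facet
    and crosses no d-arc is itself a d-arc, since a point of it, written with
    the vertices of the simplex that contains it, yields a dependency
    ([complete], [noncrossing_d_arc]).

    Mutable arcs. Suppose that [A] is exchanged for [B]. By completeness [A] and
    [B] cross. Let [C], [A], [D] be a retrograde pair, obtained by moving [v]
    to [y] and then its predecessor [p] to [u], where [u] comes before [v].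
    The element of [B] between [p] and [y] comes before [v], and then [B]
    crosses [C], or after [u], and then [B] crosses [D] ([retro_blocks]); but
    [C] and [D] survive the exchange ([mutable_not_middle]).

    Arcs outside the middle of all retrograde paths. The simplices containing
    [A] form a complete fan around [A] ([star_complete]), so that every gap of
    [A] contains a vertex joined to [A] ([gap_vertex]). Two such vertices in
    one gap would give a retrograde pair through [A] ([two_vertices_retro]):
    the shortest moves of the two ends of the gap into the gap stay on
    different sides, and shortest moves are arrows ([quiver_move]). So each gap
    contains a single vertex; these vertices form a set [B] crossing [A], and
    completeness of the fan puts every facet of the simplex on [A :|: B] that
    contains [A] into the triangulation ([single_vertices_flip]). Replacing
    them by the facets that contain [B] is a bistellar flip ([flip_tri],
    [flip_mutable]).

    A retrograde pair always lies on a maximal retrograde path, because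
    retrograde paths have bounded length: after [d.+1] steps every element of
    the initial simplex has moved forward inside its gap, so that the simplex
    reached crosses the initial one ([retrograde_path_short]). *)

(** * The cyclic order *)

Section CyclicOrder.
Variable N : nat.
Implicit Types (x y z l u v : 'I_N) (X Y Z : {set 'I_N}).

(** The number of steps from [x] forward to [y]; with this formula
    [shift_lt l x y] is [dist l x < dist l y] by definition. *)
Definition dist x y : nat := (y + (N - x)) %% N.

Lemma distE x y :
  dist x y = if (x <= y)%N then (y - x)%N else (N + y - x)%N.
Proof.
rewrite /dist; have := ltn_ord x; have := ltn_ord y => hy hx.
case: leqP => xy; last by rewrite modn_small; lia.
have -> : (y + (N - x) = N + (y - x))%N by lia.
by rewrite modnDl modn_small //; lia.
Qed.

(** Seen from any origin [l], a distance is a difference of two positions, up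
    to one turn; this turns statements on the cyclic order into linear
    arithmetic. *)
Lemma dist_base l x y :
  dist x y = if (dist l x <= dist l y)%N then (dist l y - dist l x)%N
             else (N + dist l y - dist l x)%N.
Proof.
rewrite !distE; have := ltn_ord x; have := ltn_ord y; have := ltn_ord l.
by move=> ? ? ?; repeat case: ifP; lia.
Qed.

Lemma dist_lt x y : (dist x y < N)%N.
Proof. by rewrite /dist ltn_mod; have := ltn_ord x; lia. Qed.

Lemma distxx x : dist x x = 0%N.
Proof. by rewrite distE leqnn subnn. Qed.

Lemma dist_inj l : injective (dist l).
Proof.
move=> x y; rewrite !distE => h; apply/val_inj => /=.
have := ltn_ord x; have := ltn_ord y; have := ltn_ord l.
by move: h; repeat case: ifP; lia.
Qed.

Lemma dist_eq0 x y : (dist x y == 0%N) = (x == y).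
Proof.
by apply/eqP/eqP => [|->]; [rewrite -(distxx x) => /dist_inj|exact: distxx].
Qed.

Lemma dist_gt0 x y : x != y -> (0 < dist x y)%N.
Proof. by rewrite lt0n dist_eq0. Qed.

Definition between x y z := (0 < dist x z)%N && (dist x z < dist x y)%N.

Lemma between_ltn x y z : x != y -> z != x -> z != y ->
  between x y z = ((x < y)%N == ((x < z)%N (+) (y < z)%N)).
Proof.
rewrite -!val_eqE /= /between !distE.
have := ltn_ord x; have := ltn_ord y; have := ltn_ord z.
move=> ? ? ? ? ? ?; case: (ltnP x y) => ?; case: (ltnP x z) => ?; case: (ltnP y z) => ? /=;
  by repeat case: ifP; move=> *; apply/idP/idP; lia.
Qed.

Lemma between_neq x y z : between x y z -> x != y.
Proof. by apply: contraTneq => ->; rewrite /between distxx ltn0 andbF. Qed.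

Lemma between_neql x y z : between x y z -> z != x.
Proof. by apply: contraTneq => ->; rewrite /between distxx. Qed.

Lemma between_neqr x y z : between x y z -> z != y.
Proof. by apply: contraTneq => ->; rewrite /between ltnn andbF. Qed.

Lemma between_rev_disj x y z : between x y z -> between y x z -> False.
Proof.
rewrite /between (dist_base x y z) (dist_base x y x) distxx.
have := dist_lt x y; have := dist_lt x z.
by repeat case: ifP; lia.
Qed.

Lemma between_shorten x y z : between x y z -> (dist z y < dist x y)%N.
Proof. by rewrite /between (dist_base x z); case: ifP; lia. Qed.

Lemma between_chain x u v y w : between x v u -> (dist x v <= dist x y)%N ->
  between y x w -> between u w v.
Proof.
move=> /andP[a1 a2] vy yw; have := dist_gt0 (between_neq yw); move: yw.
rewrite /between !(dist_base x u) !(dist_base x y) distxx.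
have := dist_lt x y; have := dist_lt x w; have := dist_lt x v.
by repeat (case: ifP); lia.
Qed.

Lemma dist_ordS x y : y != ord_pred x -> dist x (ordS y) = (dist x y).+1.
Proof.
have xy := ltn_ord y; have xN := ltn_ord x => ne.
have : (x + N).-1 %% N != y by apply: contraNneq ne => h; apply/eqP/val_inj.
rewrite !distE /=.
have [e|ne1] := eqVneq y.+1 N.
  rewrite e modnn; have [x0|x0] := posnP x; last by case: ifP; case: ifP; lia.
  by rewrite x0 add0n modn_small; lia.
rewrite (@modn_small y.+1); last by lia.
have [x0|x0] := posnP x; first by rewrite x0 !leq0n !subn0.
have -> : ((x + N).-1 = N + x.-1)%N by lia.
rewrite modnDl modn_small; last by lia.
by case: ifP; case: ifP; lia.
Qed.

Lemma ordS_neq x : (1 < N)%N -> ordS x != x.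
Proof.
move=> N1; apply/eqP => /(congr1 val) /=; have xN := ltn_ord x.
have [e|ne] := eqVneq x.+1 N; first by rewrite e modnn; lia.
by rewrite modn_small; lia.
Qed.

Lemma dist_succ x : (1 < N)%N -> dist x (ordS x) = 1%N.
Proof.
move=> N1; rewrite dist_ordS ?distxx //.
by apply: contraNneq (ordS_neq x N1) => {1}->; rewrite ord_predK.
Qed.

Lemma dist_pred x y : y != x -> dist x (ord_pred y) = (dist x y).-1.
Proof.
move=> ne; rewrite -{2}(ord_predK y) dist_ordS //.
by apply: contraNneq ne => /ord_pred_inj ->.
Qed.

Lemma dist_pred_self x : dist x (ord_pred x) = N.-1.
Proof.
have xN := ltn_ord x; rewrite distE /=.
have [x0|x0] := posnP x; first by rewrite x0 add0n modn_small ?leq0n ?subn0 //; lia.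
have -> : ((x + N).-1 = N + x.-1)%N by lia.
by rewrite modnDl modn_small ?ifF; lia.
Qed.

Lemma dist_from_pred l y : y != ord_pred l -> dist (ord_pred l) y = (dist l y).+1.
Proof.
move=> ne; rewrite (dist_base l) dist_pred_self; have := dist_lt l y.
have : dist l y != N.-1 by rewrite -(dist_pred_self l); apply: contraNneq ne => /dist_inj ->.
by case: ifP; lia.
Qed.

Lemma dist_pred2 x y : dist (ord_pred x) (ord_pred y) = dist x y.
Proof.
have [->|ne] := eqVneq y x; first by rewrite !distxx.
have ne' : ord_pred y != ord_pred x by apply: contraNneq ne => /ord_pred_inj ->.
by rewrite dist_from_pred // dist_pred // prednK // dist_gt0 // eq_sym.
Qed.

Lemma between_pred2 x y z : x != y ->
  between (ord_pred x) (ord_pred y) z = ((dist x z).+1 < dist x y)%N.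
Proof.
move=> xy; rewrite /between dist_pred2; have [->|ne] := eqVneq z (ord_pred x).
  by rewrite distxx dist_pred_self; have := dist_lt x y; have := dist_gt0 xy; lia.
by rewrite dist_from_pred //=.
Qed.

Lemma iter_ordS x k : (iter k (@ordS N) x : nat) = ((x + k) %% N)%N.
Proof.
elim: k => [|k IH]; first by rewrite addn0 modn_small // ltn_ord.
by rewrite iterS /= IH -[((_ %% _).+1)]addn1 modnDml addn1 addnS.
Qed.

Lemma iter_ordS_dist x y : iter (dist x y) (@ordS N) x = y.
Proof.
apply/val_inj; rewrite /= iter_ordS /dist modnDmr.
have -> : (x + (y + (N - x)) = N + y)%N by have := ltn_ord x; lia.
by rewrite modnDl modn_small.
Qed.

Lemma shift_ltE l x y : shift_lt l x y = (dist l x < dist l y)%N.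
Proof. by []. Qed.

Lemma cyclic_lt3P x y z : cyclic_lt3 x y z <-> between x z y.
Proof.
split=> [[l]|h]; last by exists x; rewrite !shift_ltE distxx.
rewrite !shift_ltE /between !(dist_base l x) => /andP[h1 h2].
by have := dist_lt l z; repeat case: ifP; lia.
Qed.

(** Going round a set, a property handed over from each element to its
    predecessor holds everywhere as soon as it holds somewhere: otherwise a
    closest pair made of a failure followed by a success would be adjacent. *)
Lemma cyclic_propagate X (P : pred 'I_N) :
  (forall b a, b \in X -> a \in X -> b != a ->
     (forall z, z \in X -> ~~ between b a z) -> P a -> P b) ->
  forall a0, a0 \in X -> P a0 -> forall b, b \in X -> P b.
Proof.
move=> step a0 a0X Pa0 b bX; apply/negP => /negP Pb.
pose bad := fun k => [exists b, exists a, [&& b \in X, a \in X, ~~ P b, P a & dist b a == k]].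
have exk : exists k, bad k.
  by exists (dist b a0); apply/existsP; exists b; apply/existsP; exists a0; apply/and5P.
case: (ex_minnP exk) => k /existsP[b1 /existsP[a1 /and5P[b1X a1X Pb1 Pa1 /eqP dk]]] kmin.
have ne : b1 != a1 by apply: contraNneq Pb1 => ->.
move: (Pb1); rewrite (step b1 a1) // => z zX; apply/negP => zarc.
have {}kmin (k' : nat) : bad k' -> ~~ (k' < k)%N by move=> /kmin; rewrite leqNgt.
case Pz: (P z).
  have /kmin/negP : bad (dist b1 z).
    by apply/existsP; exists b1; apply/existsP; exists z; apply/and5P.
  by apply; rewrite -dk; case/andP: zarc.
have /kmin/negP : bad (dist z a1).
  by apply/existsP; exists z; apply/existsP; exists a1; apply/and5P; rewrite Pz.
by apply; rewrite -dk; apply: between_shorten zarc.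
Qed.

Lemma next_exists X x : (1 < #|X|)%N -> x \in X ->
  exists2 y, y \in X :\ x & forall z, z \in X -> z != x -> (dist x y <= dist x z)%N.
Proof.
move=> X1 xX; have : (0 < #|X :\ x|)%N by move: X1; rewrite (cardsD1 x) xX.
case/card_gt0P => y0 y0X.
case: (arg_minnP (fun y => dist x y) y0X) => y yX ymin.
by exists y => // z zX zx; apply: ymin; apply/setD1P.
Qed.

(** The open gap of [X] that starts at [x]. Quantifying over all of [X] avoids
    naming the successor of [x]. *)
Definition gap X x y := [forall z in X, (z != x) ==> between x z y].

Lemma gapP X x y :
  reflect (forall z, z \in X -> z != x -> between x z y) (gap X x y).
Proof.
apply: (iffP forall_inP) => h z zX.
  by move=> zx; have := h z zX; rewrite zx.
by apply/implyP => zx; apply: h.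
Qed.

Lemma gap_notin X x y : (1 < #|X|)%N -> x \in X -> gap X x y -> y \notin X.
Proof.
move=> X1 xX /gapP g; apply/negP => yX.
have [z] := next_exists X1 xX; rewrite !inE => /andP[zx zX] _.
have yx := between_neql (g _ zX zx).
by have := between_neqr (g _ yX yx); rewrite eqxx.
Qed.

Lemma next_gap X x y u : y \in X -> y != x ->
  (forall z, z \in X -> z != x -> (dist x y <= dist x z)%N) ->
  gap X x u = between x y u.
Proof.
move=> yX yx ymin; apply/gapP/idP => [|/andP[u0 uy] z zX zx]; first exact.
by rewrite /between u0 (leq_trans uy) ?ymin.
Qed.

Lemma gap_exists X u : (0 < #|X|)%N -> u \notin X -> exists2 x, x \in X & gap X x u.
Proof.
case/card_gt0P => x0 x0X uX; have [x xX xmin] := arg_minnP (fun x => dist x u) x0X.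
exists x => //; apply/gapP => z zX zx.
have zu : z != u by apply: contraNneq uX => <-.
have xu : x != u by apply: contraNneq uX => <-.
have := xmin z zX; rewrite /between (dist_gt0 xu) /= (dist_base x z u).
have : dist x z != dist x u by apply: contraNneq zu => /dist_inj ->.
have : (0 < dist x z)%N by rewrite dist_gt0 // eq_sym.
have := dist_lt x z; have := dist_lt x u; case: ifP; lia.
Qed.

End CyclicOrder.

(** * Crossing sets *)

Section Crossing.
Variables (N d : nat).
Hypothesis d_gt0 : (0 < d)%N.
Implicit Types (x y z l u v : 'I_N) (X Y Z : {set 'I_N}).

(** Intertwining without indices: [Z] consists of one element in each gap of
    [X]. *)
Definition cross X Z := #|X| = d.+1 /\
  exists2 f : 'I_N -> 'I_N, Z = [set f x | x in X] &
    forall x, x \in X -> gap X x (f x).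

Lemma cross_sep X x : #|X| = d.+1 -> exists2 y, y \in X & y != x.
Proof.
move=> cX; have : (0 < #|X :\ x|)%N.
  rewrite lt0n; apply/eqP => h; have := cardsD1 x X.
  by rewrite cX h; case: (x \in X) => /= e; move: d_gt0; lia.
by case/card_gt0P => y; rewrite !inE => /andP[]; exists y.
Qed.

Lemma card_gt1 X : #|X| = d.+1 -> (1 < #|X|)%N.
Proof. by move->. Qed.

Lemma gap_inj X x y u : x \in X -> y \in X -> gap X x u -> gap X y u -> x = y.
Proof.
move=> xX yX /gapP gx /gapP gy; apply/eqP/negPn/negP => xy.
have yx : y != x by rewrite eq_sym.
exact: between_rev_disj (gx _ yX yx) (gy _ xX xy).
Qed.

Lemma crossE X f : #|X| = d.+1 -> (forall x, x \in X -> gap X x (f x)) ->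
  cross X [set f x | x in X].
Proof. by move=> cX fP; split=> //; exists f. Qed.

Lemma cross_card X Z : cross X Z -> #|X| = d.+1 /\ #|Z| = d.+1.
Proof.
case=> cX [f -> fP]; split=> //; rewrite card_in_imset // => x y xX yX e.
by apply: (gap_inj xX yX (fP _ xX)); rewrite e; apply: fP.
Qed.

Lemma cross_disj X Z : cross X Z -> forall x, x \in X -> x \notin Z.
Proof.
case=> cX [f -> fP] x xX; apply/imsetP => -[y yX e].
by have := gap_notin (card_gt1 cX) yX (fP _ yX); rewrite -e xX.
Qed.

Lemma cross_cardU X Z : cross X Z -> #|X :|: Z| = (2 * d).+2.
Proof.
move=> cXZ; have [cX cZ] := cross_card cXZ; rewrite cardsU cX cZ.
suff -> : #|X :&: Z| = 0%N by lia.
apply: eq_card0 => x; rewrite inE; apply/negP => /andP[xX xZ].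
by have := cross_disj cXZ xX; rewrite xZ.
Qed.

(** If [f x] lies in the gap after [x], then the successor of [x] lies in the
    gap after [f x]. *)
Lemma cross_sym X Z : cross X Z -> cross Z X.
Proof.
move=> cXZ; have [cX cZ] := cross_card cXZ; case: (cXZ) => _ [f fE fP].
(* [nx] is the successor in [X], and [g] below is the inverse of [f]. *)
pose nx x := odflt x [pick y in X :\ x | [forall z in X, (z != x) ==> (dist x y <= dist x
  z)%N]].
have nxP x : x \in X -> [/\ nx x \in X, nx x != x &
    forall z, z \in X -> z != x -> (dist x (nx x) <= dist x z)%N].
  move=> xX; rewrite /nx; case: pickP => [y /=|].
    rewrite !inE => /andP[/andP[-> ->] /forall_inP h]; split=> // z zX zx.
    by have := h _ zX; rewrite zx.
  have [y yX ymin] := next_exists (card_gt1 cX) xX.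
  move=> /(_ y); rewrite yX /= => /negbT/negP[]; apply/forall_inP => z zX.
  by apply/implyP => zx; apply: ymin.
pose g z := odflt z [pick x in X | f x == z].
have gP x : x \in X -> g (f x) = x.
  move=> xX; rewrite /g; case: pickP => [y /= /andP[yX /eqP e]|/(_ x)]; last by rewrite xX eqxx.
  by apply: (gap_inj yX xX (fP _ yX)); rewrite e; apply: fP.
have nx_inj : {in X &, injective nx}.
  move=> x y xX yX e; have [nX nx' nmin] := nxP _ xX; have [mX ny mmin] := nxP _ yX.
  apply/eqP/negPn/negP => xy.
  have := nmin _ yX (_ : y != x); rewrite eq_sym xy => /(_ isT).
  have := mmin _ xX xy.
  rewrite -e !(dist_base x y) distxx; have := dist_lt x y.
  have := dist_gt0 xy; have := dist_lt x (nx x).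
  have : dist x (nx x) != dist x y by apply: contraNneq ny => /dist_inj; rewrite e => ->.
  have : (0 < dist x (nx x))%N by rewrite dist_gt0 // eq_sym.
  by repeat case: ifP; lia.
split=> //; exists (fun z => nx (g z)).
  apply/eqP; rewrite eqEcard; apply/andP; split; last first.
    by rewrite cX -cZ leq_imset_card.
  have sub : [set nx x | x in X] \subset X by apply/subsetP => _ /imsetP[x xX ->]; case:
    (nxP _ xX).
  have /eqP e : [set nx x | x in X] == X by rewrite eqEcard sub (card_in_imset nx_inj) /=.
  apply/subsetP => x; rewrite -{1}e => /imsetP[w wX ->].
  by apply/imsetP; exists (f w); [rewrite fE imset_f|rewrite /= gP].
move=> z zZ; move: (zZ); rewrite fE => /imsetP[x xX ->]; apply/gapP => z'.
move=> /imsetP[y yX ->] ne; rewrite gP //.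
have xy : y != x by apply: contraNneq ne => ->.
have [nX nx' nmin] := nxP _ xX.
have yx : x != y by rewrite eq_sym.
have b1 := gapP _ _ _ (fP _ xX) _ nX nx'.
exact: between_chain b1 (nmin _ yX xy) (gapP _ _ _ (fP _ yX) _ xX yx).
Qed.

Lemma cross_between X Z : cross X Z -> forall x y, x \in X -> y \in X -> x != y ->
  exists2 z, z \in Z & between x y z.
Proof.
case=> cX [f -> fP] x y xX yX xy; exists (f x); first exact: imset_f.
by apply: (gapP _ _ _ (fP _ xX)); rewrite // eq_sym.
Qed.

Lemma intertwining_cross X Z : intertwining d X Z -> cross X Z.
Proof.
case=> l [a [b [-> -> ab ba]]].
have mono (i j : 'I_d.+1) : (i < j)%N -> (dist l (b i) < dist l (a j))%N.
  case: j => j; elim: j => // j IH jd /=; rewrite ltnS leq_eqVlt => /orP[/eqP e|ij].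
    by apply: ba; rewrite /= e.
  have jd' : (j < d.+1)%N by apply: ltnW.
  apply: (ltn_trans (IH jd' ij)); apply: ltn_trans (ab _) _; exact: ba.
have a_inj : injective a.
  have lt (i j : 'I_d.+1) : (i < j)%N -> a i <> a j.
    move=> ij e; have := mono _ _ ij; rewrite -e; have := ab i; rewrite shift_ltE; lia.
  move=> i j e; apply/val_inj => /=; case: (ltngtP i j) => // h; first by case: (lt _ _ h).
  by case: (lt _ _ h).
split; first by rewrite card_imset // card_ord.
pose f z := odflt z (omap b [pick i | a i == z]).
have fE i : f (a i) = b i.
  rewrite /f; case: pickP => [j /eqP /a_inj -> //|/(_ i)]; by rewrite eqxx.
exists f; first by rewrite -imset_comp; apply: eq_imset => i /=; rewrite fE.
move=> _ /imsetP[i _ ->]; apply/gapP => _ /imsetP[j _ ->] ne; rewrite fE.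
have ij : i <> j by move=> e; rewrite e eqxx in ne.
have := ab i; rewrite shift_ltE /between !(dist_base l (a i)) => h.
have := dist_lt l (b i); have := dist_lt l (a j).
case: (ltngtP i j) => [lt|gt|/val_inj //].
  by have := mono _ _ lt; repeat case: ifP; lia.
by have := mono _ _ gt; have := ab j; rewrite shift_ltE; repeat case: ifP; lia.
Qed.

End Crossing.

Local Open Scope ring_scope.

(** * Dependencies between points of the moment curve *)

Section Moments.
Variables (R : realType) (N d : nat) (t : 'I_N -> R).
Hypothesis t_incr : forall i j : 'I_N, (i < j)%N -> t i < t j.
Hypothesis d_gt0 : (0 < d)%N.
Implicit Types (x y z i j : 'I_N) (A B S U X Z : {set 'I_N}) (c w g : 'I_N -> R).
Implicit Types (p q : {poly R}).

Lemma t_ltE i j : (t i < t j) = (i < j)%N.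
Proof.
case: (ltngtP i j) => [/t_incr -> //|/t_incr ji|/val_inj ->]; last by rewrite ltxx.
by apply/negbTE; rewrite -leNgt ltW.
Qed.

Lemma t_inj : injective t.
Proof.
move=> i j e; apply/val_inj => /=; case: (ltngtP i j) => // /t_incr; by rewrite e ltxx.
Qed.

(** A weight on the labels is treated as the linear form that it defines on
    polynomials; the forms on polynomials of degree at most [2 * d] are the
    space spanned by the cone over the cyclic polytope. *)
Definition ev c q : R := \sum_i c i * q.[t i].

Definition same_moments c c' :=
  forall q, (size q <= (2 * d).+1)%N -> ev c q = ev c' q.

Definition dependency c :=
  forall q, (size q <= (2 * d).+1)%N -> ev c q = 0.

Definition supported c S := forall i, i \notin S -> c i = 0.

Lemma ev_supp c S q : supported c S -> ev c q = \sum_(i in S) c i * q.[t i].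
Proof.
move=> sc; rewrite /ev (bigID (mem S)) /= [X in _ + X]big1 ?addr0 // => i iS.
by rewrite sc ?mul0r.
Qed.

Lemma ev_lin a b c c' q :
  ev (fun i => a * c i + b * c' i) q = a * ev c q + b * ev c' q.
Proof.
rewrite /ev !big_distrr /= -big_split; apply: eq_bigr => i _ /=.
by rewrite mulrDl !mulrA.
Qed.

Lemma ev_sub c c' q : ev (fun i => c i - c' i) q = ev c q - ev c' q.
Proof.
by rewrite /ev -sumrB; apply: eq_bigr => i _; rewrite mulrBl.
Qed.

Lemma same_moments_dep c c' : same_moments c c' -> dependency (fun i => c i - c' i).
Proof. by move=> h q sq; rewrite ev_sub h // subrr. Qed.

Definition nodal S : {poly R} := \prod_(j in S) ('X - (t j)%:P).

Lemma size_nodal S : size (nodal S) = #|S|.+1.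
Proof. by rewrite /nodal -big_enum size_prod_XsubC -cardE. Qed.

Lemma nodal_root S i : i \in S -> (nodal S).[t i] = 0.
Proof.
by move=> iS; rewrite /nodal horner_prod (bigD1 i) //= hornerXsubC subrr mul0r.
Qed.

Lemma nodal_neq0 S i : i \notin S -> (nodal S).[t i] != 0.
Proof.
move=> iS; rewrite /nodal horner_prod; apply/prodf_neq0 => j jS.
by rewrite hornerXsubC subr_eq0; apply: contraNneq iS => /t_inj ->.
Qed.

(** The Lagrange basis polynomials at the parameters of [S]. *)
Definition basis_poly S i : {poly R} :=
  \prod_(j in S :\ i) ((t i - t j)^-1 *: ('X - (t j)%:P)).

Lemma horner_basis_poly S i k : i \in S -> k \in S ->
  (basis_poly S i).[t k] = (k == i)%:R.
Proof.
move=> iS kS; rewrite horner_prod; have [->|ki] := eqVneq k i.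
  rewrite big1 // => j; rewrite !inE => /andP[ji _].
  rewrite hornerZ hornerXsubC mulVf // subr_eq0.
  by apply: contraNneq ji => /t_inj ->.
by rewrite (bigD1 k) ?inE ?ki //= hornerZ hornerXsubC subrr mulr0 mul0r.
Qed.

Lemma size_basis_poly S i : (size (basis_poly S i) <= #|S :\ i|.+1)%N.
Proof.
rewrite /basis_poly scaler_prod; apply: (leq_trans (size_scale_leq _ _)).
by rewrite -/(nodal _) size_nodal.
Qed.

(** The basis polynomials isolate each coefficient of the dependency. *)
Lemma dep_free c S : dependency c -> supported c S -> (#|S| <= (2 * d).+1)%N ->
  forall i, c i = 0.
Proof.
move=> dc sc cS i; have [iS|/sc //] := boolP (i \in S).
have := dc (basis_poly S i); rewrite (leq_trans (size_basis_poly _ _)); last first.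
  by move: cS; rewrite (cardsD1 i S) iS.
move=> /(_ isT); rewrite (ev_supp _ sc) (bigD1 i) //= horner_basis_poly // eqxx mulr1.
rewrite big1 ?addr0 // => k /andP[kS ki].
by rewrite horner_basis_poly // (negbTE ki) mulr0.
Qed.

Lemma poly_small0 q S : (size q <= #|S|)%N -> (forall i, i \in S -> q.[t i] = 0) -> q = 0.
Proof.
move=> sq q0; apply: (@roots_geq_poly_eq0 _ q [seq t i | i <- enum S]).
- by apply/allP => _ /mapP[i iS ->]; rewrite /root q0 // -mem_enum.
- by rewrite map_inj_uniq ?enum_uniq //; apply: t_inj.
- by rewrite size_map -cardE.
Qed.

Lemma interpolation q S : (size q <= #|S|)%N ->
  q = \sum_(i in S) q.[t i] *: basis_poly S i.
Proof.
move=> sq; apply/eqP; rewrite -subr_eq0; apply/eqP; apply: (@poly_small0 _ S).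
  apply: (leq_trans (size_polyD _ _)); rewrite size_polyN geq_max sq /=.
  apply: (leq_trans (size_sum _ _ _)); apply/bigmax_leqP => i iS.
  apply: (leq_trans (size_scale_leq _ _)); apply: (leq_trans (size_basis_poly _ _)).
  by rewrite (cardsD1 i S) iS.
move=> k kS; rewrite hornerD hornerN horner_sum (bigD1 k) //= hornerZ.
rewrite horner_basis_poly // eqxx mulr1 big1 ?addr0 ?subrr // => i /andP[iS ik].
by rewrite hornerZ horner_basis_poly // eq_sym (negbTE ik) mulr0.
Qed.

(** The coordinates of [g] with respect to the points labelled by [S], when
    there are [(2 * d).+1] of them. *)
Definition bary S g i : R := if i \in S then ev g (basis_poly S i) else 0.

Lemma bary_supp S g : supported (bary S g) S.
Proof. by move=> i iS; rewrite /bary (negbTE iS). Qed.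

Lemma bary_moments S g : #|S| = (2 * d).+1 -> same_moments (bary S g) g.
Proof.
move=> cS q sq; rewrite (ev_supp _ (@bary_supp S g)).
rewrite {2}(@interpolation q S) ?cS // /ev.
under [RHS]eq_bigr => i _ do rewrite horner_sum big_distrr /=.
rewrite exchange_big /=; apply: eq_bigr => k kS; rewrite /bary kS /ev big_distrl /=.
by apply: eq_bigr => i _; rewrite hornerZ -!mulrA [q.[_] * _]mulrC.
Qed.

Lemma moments_uniq S c c' : #|S| = (2 * d).+1 -> same_moments c c' ->
  supported c S -> supported c' S -> c =1 c'.
Proof.
move=> cS /same_moments_dep dc sc sc' i.
apply/eqP; rewrite -subr_eq0; apply/eqP.
apply: (@dep_free (fun i => c i - c' i) S) => //; last by rewrite cS.
by move=> k kS; rewrite sc // sc' // subrr.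
Qed.

(** One of the points is a combination of the [(2 * d).+1] others. *)
Lemma dep_exists U : #|U| = (2 * d).+2 ->
  exists2 c, dependency c & supported c U /\ exists i, c i != 0.
Proof.
move=> cU; have : (0 < #|U|)%N by rewrite cU.
case/card_gt0P => u uU; set S := U :\ u.
have cS : #|S| = (2 * d).+1 by move: cU; rewrite (cardsD1 u) uU => -[].
pose g i : R := (i == u)%:R.
exists (fun i => bary S g i - g i); first exact: same_moments_dep (bary_moments _ cS).
split; last first.
  by exists u; rewrite bary_supp ?inE ?eqxx // /g eqxx sub0r oppr_eq0 oner_eq0.
move=> i iU; rewrite bary_supp ?inE ?(negbTE iU) ?andbF // /g.
have -> : (i == u) = false by apply: contraNF iU => /eqP ->.
by rewrite subrr.
Qed.

(** The polynomial has double zeros on [X] except for simple ones at [x] and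
    [y], so that up to a sign it is negative exactly between [x] and [y]. *)
Lemma between_poly X x y : #|X| = d.+1 -> x \in X -> y \in X -> x != y ->
  exists2 q : {poly R}, (size q <= (2 * d).+1)%N &
    (forall i, i \in X -> q.[t i] = 0) /\
    (forall i, i \notin X -> if between x y i then q.[t i] < 0 else 0 < q.[t i]).
Proof.
move=> cX xX yX xy; pose s : R := if (x < y)%N then 1 else -1.
pose r := nodal (X :\ x :\ y).
have cr : #|X :\ x :\ y| = d.-1.
  have yX' : y \in X :\ x by rewrite !inE eq_sym xy.
  by have := cardsD1 x X; have := cardsD1 y (X :\ x); rewrite xX yX' cX => -> [->].
have sr : size r = d by rewrite size_nodal cr prednK.
exists (s *: (('X - (t x)%:P) * ('X - (t y)%:P) * (r * r))); last split.
- apply: (leq_trans (size_scale_leq _ _)); apply: (leq_trans (size_polyMleq _ _)).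
  have := size_polyMleq r r; rewrite sr => srr.
  have := size_polyMleq ('X - (t x)%:P) ('X - (t y)%:P); rewrite !size_XsubC => sxy.
  rewrite -subn1; apply: (leq_trans (leq_sub2r 1 (leq_add sxy srr))).
  by lia.
- move=> i iX; rewrite hornerZ !hornerM !hornerXsubC.
  have [->|ix] := eqVneq i x; first by rewrite subrr !(mul0r,mulr0).
  have [->|iy] := eqVneq i y; first by rewrite subrr !(mul0r,mulr0).
  by rewrite /r nodal_root ?inE ?ix ?iy // !(mul0r,mulr0).
move=> i iX; rewrite hornerZ !hornerM !hornerXsubC.
have r0 : 0 < r.[t i] * r.[t i].
  by rewrite -expr2 exprn_even_gt0 //= nodal_neq0 // !inE (negbTE iX) !andbF.
have sx : t i - t x = (if (x < i)%N then 1 else -1) * `|t i - t x|.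
  case: ifP => xi; first by rewrite mul1r gtr0_norm // subr_gt0 t_ltE.
  by rewrite ler0_norm ?mulN1r ?opprK // subr_le0 leNgt t_ltE xi.
have sy : t i - t y = (if (y < i)%N then 1 else -1) * `|t i - t y|.
  case: ifP => xi; first by rewrite mul1r gtr0_norm // subr_gt0 t_ltE.
  by rewrite ler0_norm ?mulN1r ?opprK // subr_le0 leNgt t_ltE xi.
have nz j : j \in X -> 0 < `|t i - t j|.
  by move=> jX; rewrite normr_gt0 subr_eq0; apply: contraNneq iX => /t_inj ->.
have ix : i != x by apply: contraNneq iX => ->.
have iy : i != y by apply: contraNneq iX => ->.
have pos : 0 < `|t i - t x| * `|t i - t y| * (r.[t i] * r.[t i]).
  by apply: mulr_gt0 => //; apply: mulr_gt0; apply: nz.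
pose a : R := if (x < i)%N then 1 else -1; pose b : R := if (y < i)%N then 1 else -1.
have sg : s * (a * b) = if between x y i then -1 else 1.
  rewrite between_ltn // /s /a /b; do 3 case: ltnP => _ //=;
    by rewrite ?mul1r ?mulN1r ?mulr1 ?mulrN1 ?opprK.
rewrite sx sy -/a -/b.
have -> : s * (a * `|t i - t x| * (b * `|t i - t y|) * (r.[t i] * r.[t i])) =
    s * (a * b) * (`|t i - t x| * `|t i - t y| * (r.[t i] * r.[t i])).
  by rewrite [X in s * (X * _)]mulrACA !mulrA.
rewrite sg.
by case: (between x y i); rewrite ?mul1r // mulN1r oppr_lt0.
Qed.

(** Otherwise some gap of [X] contains no negative coefficient, and all terms of
    the relation given by the polynomial of that gap have the same sign; then
    the dependency is supported on [X], hence trivial. *)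
Lemma dep_cross c X : dependency c -> #|X| = d.+1 -> (exists i, c i != 0) ->
  (forall i, i \notin X -> c i <= 0) ->
  exists2 Z, cross d X Z & forall z, z \in Z -> c z < 0.
Proof.
move=> dc cX [i0 ci0] cneg.
have X1 : (1 < #|X|)%N by rewrite cX.
have ex x : x \in X -> exists z, gap X x z && (c z < 0).
  move=> xX; have [y] := next_exists X1 xX; rewrite !inE => /andP[yx yX] ymin.
  apply/existsP; rewrite -[[exists _, _]]negbK negb_exists; apply/negP => /forallP no.
  have xy : x != y by rewrite eq_sym.
  have [q sq [q0 qs]] := between_poly cX xX yX xy.
  have cX0 i : i \notin X -> c i = 0.
    have le0 j : c j * q.[t j] <= 0.
      have [jX|jX] := boolP (j \in X); first by rewrite q0 ?mulr0.
      have := qs j jX; case: ifP => [ja|_] h; last by rewrite mulr_le0_ge0 ?cneg ?ltW.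
      have : ~~ (c j < 0) by have := no j; rewrite (next_gap _ yX yx ymin) ja.
      by rewrite -leNgt => h'; apply: mulr_ge0_le0 => //; apply: ltW.
    move=> iX; have /eqP := dc q sq; rewrite /ev -oppr_eq0 -sumrN psumr_eq0; last first.
      by move=> j _; rewrite oppr_ge0 le0.
    move=> /allP/(_ i (mem_index_enum _))/=; rewrite oppr_eq0 mulf_eq0.
    case/orP => [/eqP //|/eqP qi0].
    by have := qs i iX; rewrite qi0 ltxx if_same.
  move: ci0; rewrite (dep_free dc cX0) ?eqxx // cX; lia.
pose f x := odflt x [pick z | gap X x z && (c z < 0)].
have fP x : x \in X -> gap X x (f x) && (c (f x) < 0).
  move=> xX; rewrite /f; case: pickP => [z //|h]; have [z] := ex _ xX.
  by rewrite h.
exists [set f x | x in X].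
  by apply: crossE => // x /fP/andP[].
by move=> _ /imsetP[x /fP/andP[_ h] ->].
Qed.

(** The polynomial vanishing at all points of the circuit but two adjacent ones
    takes values of the same sign there, because an even number of factors
    changes sign when the two are adjacent across the origin. So the signs of
    the dependency alternate along the circuit, and so do its elements between
    [A] and [B]. *)
Lemma circuit_signs A B c : cross d A B -> dependency c -> supported c (A :|: B) ->
  (exists i, c i != 0) ->
  ((forall a, a \in A -> 0 < c a) /\ (forall b, b \in B -> c b < 0)) \/
  ((forall a, a \in A -> c a < 0) /\ (forall b, b \in B -> 0 < c b)).
Proof.
move=> cAB; have [cA cB] := cross_card cAB; have AB := cross_disj d_gt0 cAB.
have := cross_cardU d_gt0 cAB; set U := A :|: B => cU.
have Uc x : x \in U -> (x \in B) = (x \notin A).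
  rewrite !inE => xU; apply/idP/idP => [xB|xA]; last by move: xU; rewrite (negbTE xA).
  by apply/negP => xA; have := AB _ xA; rewrite xB.
wlog : c / exists2 a, a \in A & 0 <= c a => [hw|[a0 a0A ca0]] dc sc [i0 ci0].
  have : (0 < #|A|)%N by rewrite cA.
  case/card_gt0P => a0 a0A; have [h|h] := leP 0 (c a0).
    by apply: (hw c) => //; [exists a0|exists i0].
  have := hw (fun i => - c i); case.
  - by exists a0; rewrite ?oppr_ge0 ?ltW.
  - move=> q sq; have := dc q sq; rewrite /ev => e.
    by under eq_bigr => i _ do rewrite mulNr; rewrite sumrN e oppr0.
  - by move=> i iU; rewrite sc ?oppr0.
  - by exists i0; rewrite oppr_eq0.
  - case=> h1 h2; right; split=> i iI; first by rewrite -oppr_gt0 h1.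
    by rewrite -oppr_lt0 h2.
  - case=> h1 h2; left; split=> i iI; first by rewrite -oppr_lt0 h1.
    by rewrite -oppr_gt0 h2.
have cn0 x : x \in U -> c x != 0.
  move=> xU; apply/eqP => cx0; move: ci0; rewrite (@dep_free c (U :\ x)) ?eqxx //.
    move=> i; rewrite !inE negb_and negbK => /orP[/eqP -> //|iU].
    by apply: sc; rewrite !inE.
  by move: cU; rewrite (cardsD1 x) xU add1n => -[->].
have opp x y : x \in U -> y \in U -> x != y -> (forall z, z \in U -> ~~ between x y z) ->
  c x * c y < 0.
  move=> xU yU xy noz.
  pose q := nodal (U :\ x :\ y).
  have cD : #|U :\ x :\ y| = (2 * d)%N.
    have yU' : y \in U :\ x by rewrite in_setD1 eq_sym xy.
    by have := cardsD1 x U; have := cardsD1 y (U :\ x); rewrite xU yU' cU => -> [->].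
  have sq : size q = (2 * d).+1 by rewrite size_nodal cD.
  have qz i : i \in U -> i != x -> i != y -> q.[t i] = 0.
    by move=> iU ix iy; rewrite /q nodal_root // 2!in_setD1 iy ix.
  have qpos : 0 < q.[t x] * q.[t y].
    rewrite /q /nodal !horner_prod -big_split /=.
    have facs j : j \in U :\ x :\ y -> (t x - t j) * (t y - t j) != 0 /\
       (0 < (t x - t j) * (t y - t j)) = (x < y)%N.
      rewrite !in_setD1 => /and3P[jy jx jU].
      have := noz j jU; rewrite between_ltn // => nb.
      split; first by rewrite mulf_neq0 // subr_eq0; apply/eqP => /t_inj e; move: jx jy;
        rewrite e eqxx.
      move: nb; case: (ltngtP x j) => [xj|xj|/val_inj e]; last by rewrite e eqxx in jx.
        by rewrite nmulr_rgt0 ?subr_lt0 ?t_ltE //; case: (y < j)%N; case: (x < y)%N.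
      have -> : (y < j)%N = ~~ (j < y)%N by rewrite -leqNgt [RHS]leq_eqVlt; case: eqP =>
        [/val_inj e|//]; rewrite e eqxx in jy.
      by rewrite pmulr_rgt0 ?subr_gt0 ?t_ltE //; case: (j < y)%N; case: (x < y)%N.
    case: (boolP (x < y)%N) => xly.
      by apply: prodr_gt0 => j /facs[_]; rewrite xly !hornerXsubC.
    under eq_bigr => j _ do rewrite !hornerXsubC -[_ * _]opprK.
    rewrite prodrN cD mulnC exprM sqrr_sign mul1r; apply: prodr_gt0 => j /facs[n0 e].
    by rewrite oppr_gt0 lt_neqAle n0 leNgt e.
  have := dc q; rewrite sq => /(_ (leqnn _)); rewrite (ev_supp _ sc) (bigD1 x) //=.
  rewrite (bigD1 y) /=; last by rewrite yU eq_sym.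
  rewrite big1 ?addr0; last by move=> i /andP[/andP[iU ix] iy]; rewrite qz ?mulr0.
  move=> e.
  have e2 : c x * c y * (q.[t x] * q.[t y]) = - (c y * q.[t y]) ^+ 2.
    have -> : c x * c y * (q.[t x] * q.[t y]) = (c x * q.[t x]) * (c y * q.[t y]) by ring.
    by move/eqP: e; rewrite addr_eq0 => /eqP ->; rewrite mulNr expr2.
  have : c x * c y * (q.[t x] * q.[t y]) < 0.
    rewrite e2 oppr_lt0 exprn_even_gt0 //= mulf_neq0 ?cn0 //.
    by apply: contraTneq qpos => ->; rewrite mulr0 ltxx.
  by rewrite pmulr_llt0.
have all_ok : forall x, x \in U -> (x \in A) == (0 < c x).
  have a0U : a0 \in U by rewrite in_setU a0A.
  apply: (@cyclic_propagate _ U (fun x => (x \in A) == (0 < c x)) _ a0 a0U); last first.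
    by rewrite a0A lt0r ca0 cn0.
  move=> b a bU aU ba noz /eqP Pa.
  have := opp _ _ bU aU ba noz; have cb0 := cn0 _ bU.
  have AA : ~~ ((a \in A) && (b \in A)).
    apply/negP => /andP[aA bA]; have [z zB zarc] := cross_between cAB bA aA ba.
    by have := noz z; rewrite zarc !inE zB orbT => /(_ isT).
  have BB : ~~ ((a \in B) && (b \in B)).
    apply/negP => /andP[aA bA]; have [z zB zarc] := cross_between (cross_sym d_gt0 cAB)
      bA aA ba.
    by have := noz z; rewrite zarc !inE zB => /(_ isT).
  rewrite !Uc // in BB.
  have -> : (b \in A) = ~~ (a \in A) by move: AA BB; case: (a \in A); case: (b \in A).
  rewrite Pa => h; apply/eqP.
  have [ca|ca] := ltP 0 (c a).
    by apply/esym/negbTE; rewrite -leNgt ltW // -(pmulr_llt0 _ ca).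
  have ca' : c a < 0 by rewrite lt_neqAle cn0.
  by move: h; rewrite nmulr_llt0.
left; split=> [a aA|b bB].
  by have := all_ok a; rewrite aA !inE aA => /(_ isT)/eqP <-.
have bU : b \in U by rewrite !inE bB orbT.
have := all_ok b bU; have := Uc _ bU; rewrite bB => /esym/negbTE -> /eqP/esym/negbT.
by rewrite -leNgt lt_neqAle cn0.
Qed.

(** Read as an equality between its positive and its negative part, the
    dependency is a common point of the relative interiors of the two
    simplices. *)
Lemma circuit_exists A B : cross d A B -> exists c,
  [/\ dependency c, supported c (A :|: B), forall a, a \in A -> 0 < c a &
      forall b, b \in B -> c b < 0].
Proof.
move=> cAB; have [c dc [sc nz]] := dep_exists (cross_cardU d_gt0 cAB).
case: (circuit_signs cAB dc sc nz) => -[h1 h2]; first by exists c.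
exists (fun i => - c i); split=> [q sq|i iU|a aA|b bB].
- have := dc q sq; rewrite /ev => e.
  by under eq_bigr => i _ do rewrite mulNr; rewrite sumrN e oppr0.
- by rewrite sc ?oppr0.
- by rewrite oppr_gt0 h1.
- by rewrite oppr_lt0 h2.
Qed.

End Moments.

(** * Triangulations in terms of weights *)

Lemma small_perturbation (R : realFieldType) (I : finType) (f g : I -> R) :
  exists2 e, 0 < e &
    forall e', 0 < e' -> e' <= e -> forall i, 0 < f i -> 0 < f i + e' * g i.
Proof.
suff: forall s : seq I, exists2 e, 0 < e &
    forall e', 0 < e' -> e' <= e -> forall i, i \in s -> 0 < f i -> 0 < f i + e' * g i.
  move=> /(_ (enum I))[e e0 he]; exists e => // e' h1 h2 i; apply: he => //.
  by rewrite mem_enum.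
elim=> [|k s [e e0 he]]; first by exists 1.
have [fk|fk] := ltP 0 (f k); last first.
  exists e => // e' h1 h2 i; rewrite inE => /predU1P[->|]; last exact: he.
  by rewrite ltNge fk.
have g1 : 0 < 1 + `|g k| by rewrite ltr_pwDl.
exists (Num.min e (f k / (1 + `|g k|))); first by rewrite lt_min e0 divr_gt0.
move=> e' h1; rewrite le_min => /andP[h2 h3] i; rewrite inE => /predU1P[->|]; last exact: he.
move=> _; rewrite ler_pdivlMr // mulrDr mulr1 in h3.
have := ler_norm (- (e' * g k)); rewrite normrN normrM gtr0_norm //; lra.
Qed.

Section Triangulations.
Variables (R : realType) (N d : nat) (t : 'I_N -> R).
Hypothesis t_incr : forall i j : 'I_N, (i < j)%N -> t i < t j.
Hypothesis d_gt0 : (0 < d)%N.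
Implicit Types (x y z i j : 'I_N) (A B D S U X Z : {set 'I_N}) (c w g : 'I_N -> R).
Implicit Types (p q : {poly R}) (T : {set {set 'I_N}}).

Local Notation same_moments := (same_moments d t).
Local Notation dependency := (dependency d t).

Lemma same_moments_sym w w' : same_moments w w' -> same_moments w' w.
Proof. by move=> h q sq; rewrite h. Qed.

Lemma same_moments_trans w1 w2 w3 :
  same_moments w1 w2 -> same_moments w2 w3 -> same_moments w1 w3.
Proof. by move=> h1 h2 q sq; rewrite h1 // h2. Qed.

Lemma same_moments_lin a b w1 w1' w2 w2' :
  same_moments w1 w1' -> same_moments w2 w2' ->
  same_moments (fun i => a * w1 i + b * w2 i) (fun i => a * w1' i + b * w2' i).
Proof. by move=> h1 h2 q sq; rewrite !ev_lin h1 // h2. Qed.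

Lemma same_moments_ext w w' v v' : w =1 v -> w' =1 v' ->
  same_moments w w' -> same_moments v v'.
Proof.
move=> h1 h2 h q sq; have := h q sq; rewrite /ev.
by under eq_bigr do rewrite h1; under [X in _ = X]eq_bigr do rewrite h2.
Qed.

Lemma dep_same_moments c w : dependency c ->
  forall a, same_moments (fun i => w i + a * c i) w.
Proof.
move=> dc a q sq; rewrite -[RHS]addr0 -(mulr0 a) -(dc q sq) /ev big_distrr /= -big_split /=.
by apply: eq_bigr => i _; rewrite mulrDl mulrA.
Qed.

Definition positive_on S w := supported w S /\ forall i, i \in S -> 0 < w i.

(** Triangulations of the cone over the cyclic polytope: a nonnegative weight
    stands for a point of the cone, two weights stand for the same point when
    they have the same moments, and the weights positive on a simplex are the
    points of its interior. *)
Record tri T : Prop := Tri {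
  tri_card : forall S, S \in T -> #|S| = (2 * d).+1;
  tri_disj : forall S S' w w', S \in T -> S' \in T ->
    positive_on S w -> positive_on S' w' -> same_moments w w' -> S = S';
  tri_cover : forall g, (forall i, 0 <= g i) -> 0 < \sum_i g i ->
    exists S w, [/\ S \in T, supported w S, forall i, 0 <= w i & same_moments w g]
}.

(** The circuit gives a common point of the faces [A] and [B]. Adding small
    positive weights on the other vertices of [S] and of [S'] moves it into the
    two interiors; the difference is compensated on the circuit, whose points
    span the whole space. *)
Lemma noncrossing T A B S S' : tri T -> S \in T -> S' \in T ->
  A \subset S -> B \subset S' -> ~ cross d A B.
Proof.
move=> triT ST S'T AS BS' cAB.
have AB := cross_disj d_gt0 cAB.
have [c [dc sc cA cB]] := circuit_exists t_incr d_gt0 cAB.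
have BA b : b \in B -> b \notin A by move=> bB; apply: contraTN bB => /AB.
pose eA i : R := (i \in S :\: A)%:R; pose eB i : R := (i \in S' :\: B)%:R.
have : (0 < #|A :|: B|)%N by rewrite (cross_cardU d_gt0 cAB).
case/card_gt0P => u uU.
have cU : #|(A :|: B) :\ u| = (2 * d).+1.
  by have := cross_cardU d_gt0 cAB; rewrite (cardsD1 u) uU add1n => -[].
pose h := bary t ((A :|: B) :\ u) (fun i => eB i - eA i).
have hm : same_moments h (fun i => eB i - eA i) by apply: bary_moments.
have hs i : i \notin A -> i \notin B -> h i = 0.
  move=> iA iB; rewrite /h bary_supp //.
  by rewrite !inE negb_and negb_or iA iB orbT.
have [e e0 he] := small_perturbation (fun i => `|c i|)
  (fun i => if i \in A then h i else - h i).
have {}he i := he e e0 (lexx _) i.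
pose w i := (if i \in A then c i + e * h i else 0) + e * eA i.
pose w' i := (if i \in B then - (c i + e * h i) else 0) + e * eB i.
have wS : positive_on S w.
  split=> [i iS|i iS]; rewrite /w.
    rewrite (negbTE (_ : i \notin A)); last by apply: contraNN iS; apply/subsetP.
    by rewrite /eA inE (negbTE iS) andbF mulr0 addr0.
  rewrite /eA inE iS andbT; case: ifP => iA /=; last by rewrite add0r mulr1.
  have := he i; rewrite iA mulr0 addr0 gtr0_norm ?cA //; exact.
have wS' : positive_on S' w'.
  split=> [i iS|i iS]; rewrite /w'.
    rewrite (negbTE (_ : i \notin B)); last by apply: contraNN iS; apply/subsetP.
    by rewrite /eB inE (negbTE iS) andbF mulr0 addr0.
  rewrite /eB inE iS andbT; case: ifP => iB /=; last by rewrite add0r mulr1.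
  have := he i; rewrite (negbTE (BA _ iB)) mulr0 addr0 ltr0_norm ?cB //.
  by rewrite mulrN -opprD oppr_gt0 cB // => /(_ isT).
have ww' : same_moments w w'.
  have d1 : dependency (fun i => w i - w' i).
    have e1 : same_moments (fun i => e * h i + (- e) * (eB i - eA i)) (fun=> 0).
      move=> q sq; rewrite ev_lin hm // mulNr subrr /ev big1 // => i _.
      by rewrite mul0r.
    have := same_moments_lin 1 1 (dep_same_moments (fun=> 0) dc 1) e1.
    move=> h2 q sq; apply: etrans (etrans (h2 q sq) _); last first.
      by rewrite /ev big1 // => i _; rewrite mulr0 addr0 mul0r.
    apply: eq_bigr => i _; congr (_ * _).
    rewrite /w /w'; case: (boolP (i \in A)) => iA.
      by rewrite (negbTE (AB _ iA)); ring.
    case: (boolP (i \in B)) => iB; first by ring.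
    by rewrite hs // (sc i) ?inE ?(negbTE iA) //; ring.
  by move=> q sq; apply/eqP; rewrite -subr_eq0 -ev_sub d1.
have SS' := tri_disj triT ST S'T wS wS' ww'.
have : (#|A :|: B| <= #|S|)%N by apply: subset_leq_card; rewrite subUset AS SS'.
by rewrite (cross_cardU d_gt0 cAB) (tri_card triT ST) ltnn.
Qed.

(** The weights [1] on [D] and [g] on [S] of a common point differ by a
    dependency whose positive part lives on [D], so that [dep_cross] applies
    unless they are equal. *)
Lemma face_or_crossing T S D g : tri T -> S \in T -> #|D| = d.+1 ->
  supported g S -> (forall i, 0 <= g i) ->
  same_moments g (fun i => (i \in D)%:R) ->
  g =1 (fun i => (i \in D)%:R) \/ exists2 Z : {set 'I_N}, Z \subset S & cross d D Z.
Proof.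
move=> triT ST cD gS g0 gD; have dc := same_moments_dep (same_moments_sym gD).
have [/existsP nz|] := boolP [exists i, (i \in D)%:R - g i != 0]; last first.
  rewrite negb_exists => /forallP h; left=> i; have := h i.
  by rewrite negbK subr_eq0 => /eqP.
right; have [i|Z cDZ Zneg] := dep_cross t_incr d_gt0 dc cD nz.
  by move=> /negbTE ->; rewrite sub0r oppr_le0.
exists Z => //; apply/subsetP => z zZ; apply/negPn/negP => zS.
by have := Zneg z zZ; rewrite gS // subr0 ltNge ler0n.
Qed.

Lemma sum_indic_gt0 (D : {set 'I_N}) : (0 < #|D|)%N -> 0 < \sum_i (i \in D)%:R :> R.
Proof.
case/card_gt0P => i iD; rewrite (bigD1 i) //= iD ltr_pwDl //.
by apply: sumr_ge0.
Qed.

(** The simplex that contains the barycentre of [D] contains [D] or a face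
    crossing it. *)
Lemma complete T D : tri T -> #|D| = d.+1 ->
  (exists2 S, S \in T & D \subset S) \/
  (exists Z S, [/\ S \in T, Z \subset S & cross d D Z]).
Proof.
move=> triT cD; have [//||S [w [ST wS w0 wD]]] := tri_cover triT (g := fun i => (i \in D)%:R).
  by apply: sum_indic_gt0; rewrite cD.
have [e|[Z ZS cDZ]] := face_or_crossing triT ST cD wS w0 wD; last by right; exists Z, S.
left; exists S => //; apply/subsetP => i iD; apply/negPn/negP => /wS.
by rewrite e iD => /eqP; rewrite oner_eq0.
Qed.

(** The simplices containing [A] form a complete fan around [A]. The point
    [v + e * g], with [v] inside [A] and [e] small, lies in some simplex [S];
    since there are finitely many simplices, the coordinates of [v] and [g] in
    some [S] are lexicographically nonnegative. Then [v] lies in [S], so [A] is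
    a face of [S] by noncrossing, and the coordinates of [g] are nonnegative off
    [A]. *)
Lemma star_complete T A g S0 : tri T -> S0 \in T -> A \subset S0 -> #|A| = d.+1 ->
  (forall i, 0 <= g i) ->
  exists S w, [/\ S \in T, A \subset S, supported w S,
    forall i, i \notin A -> 0 <= w i & same_moments w g].
Proof.
move=> triT S0T AS0 cA g0; pose v i : R := (i \in A)%:R.
have v0 i : 0 <= v i by [].
pose good S := [forall i in S, (0 <= bary t S v i) && ((bary t S v i == 0) ==> (0 <= bary
  t S g i))].
have [/existsP[S /andP[ST /forall_inP gS]]|noS] := boolP [exists S in T, good S].
  have cS := tri_card triT ST.
  have bs0 i : 0 <= bary t S v i.
    by have [/gS/andP[]|/bary_supp ->] := boolP (i \in S).
  have [e|[Z ZS cAZ]] := face_or_crossing triT ST cA (@bary_supp _ _ t S v) bs0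
    (bary_moments t_incr v cS); last first.
    by case: (noncrossing triT S0T ST AS0 ZS cAZ).
  exists S, (bary t S g); split => //.
  - apply/subsetP => i iA; apply/negPn/negP => /(@bary_supp _ _ t S v).
    by rewrite e iA => /eqP; rewrite oner_eq0.
  - exact: bary_supp.
  - move=> i iA; have [iS|/bary_supp -> //] := boolP (i \in S).
    by have /andP[_] := gS i iS; rewrite e (negbTE iA) eqxx.
  - exact: bary_moments.
exfalso; rewrite negb_exists in noS; move/forallP: noS => noS.
pose bad S i := (i \in S) && ((bary t S v i < 0) || (bary t S v i == 0) && (bary t S g i < 0)).
have badP S : S \in T -> exists i, bad S i.
  move=> ST; have := noS S; rewrite ST /= negb_forall => /existsP[i].
  rewrite negb_imply => /andP[iS]; rewrite negb_and negb_imply -!ltNge => h.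
  by exists i; rewrite /bad iS.
pose f S : R := if [pick i | bad S i] is Some i then - bary t S v i else 0.
pose f' S : R := if [pick i | bad S i] is Some i then - bary t S g i else 0.
(* One [e] makes a bad coordinate of [v + e * g] negative in every simplex. *)
have [e e0 he] := small_perturbation f f'; have {}he := he e e0 (lexx _).
have sum0 : 0 < \sum_i (v i + e * g i).
  rewrite big_split /=; apply: ltr_pwDl; first by apply: sum_indic_gt0; rewrite cA.
  by apply: sumr_ge0 => i _; rewrite mulr_ge0 // ltW.
have [|S [w [ST wS w0 wm]]] := tri_cover triT _ sum0.
  by move=> i; rewrite addr_ge0 // mulr_ge0 // ltW.
have cS := tri_card triT ST.
have wE : w =1 (fun i => 1 * bary t S v i + e * bary t S g i).
  apply: (moments_uniq t_incr cS) => //; last first.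
    by move=> i iS; rewrite !bary_supp // !mulr0 addr0.
  apply: (same_moments_trans wm); apply: same_moments_ext (same_moments_lin 1 e
    (same_moments_sym (bary_moments t_incr v cS)) (same_moments_sym (bary_moments t_incr
      g cS))) => // i.
  by rewrite mul1r.
have := he S; rewrite /f /f'; case: pickP => [i /andP[iS]|h]; last by have [i] := badP _
  ST; rewrite h.
have := w0 i; rewrite wE mul1r => h /orP[neg|/andP[/eqP z neg]].
  by rewrite oppr_gt0 neg mulrN -opprD oppr_gt0 ltNge h => /(_ isT).
by move: h; rewrite z add0r leNgt pmulr_rlt0 // neg.
Qed.

(** Take the direction of the point [z] of the gap in [star_complete]: the
    polynomial that is negative only on this gap is negative at [z], hence at
    some vertex of the simplex that has a positive weight. *)
Lemma gap_vertex T A S0 a z : tri T -> S0 \in T -> A \subset S0 -> #|A| = d.+1 ->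
  a \in A -> gap A a z ->
  exists2 u, gap A a u & exists S, [/\ S \in T, A \subset S & u \in S].
Proof.
move=> triT S0T AS0 cA aA gz.
have [S [w [ST AS wS w0 wm]]] := star_complete triT S0T AS0 cA (g := fun i => (i ==
  z)%:R) (fun i => ler0n _ _).
have A1 : (1 < #|A|)%N by rewrite cA.
have [y] := next_exists A1 aA; rewrite !inE => /andP[ya yA] ymin.
have zA := gap_notin A1 aA gz.
rewrite (next_gap _ yA ya ymin) in gz.
have ay : a != y by rewrite eq_sym.
have [q sq [q0 qs]] := between_poly t_incr d_gt0 cA aA yA ay.
have := wm q sq; rewrite /ev [RHS](bigD1 z) //= eqxx mul1r [X in _ + X]big1 ?addr0; last first.
  by move=> i iz; rewrite (negbTE iz) mul0r.
move=> e; have : ~~ (0 <= q.[t z]) by have := qs z zA; rewrite gz -ltNge.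
rewrite -e => /negP neg.
have [/existsP[u /andP[uS gu]]|no] := boolP [exists u, (u \in S) && gap A a u].
  by exists u => //; exists S.
case: neg; apply: sumr_ge0 => i _.
have [iA|iA] := boolP (i \in A); first by rewrite q0 ?mulr0.
have [iS|iS] := boolP (i \in S); last by rewrite wS ?mul0r.
rewrite mulr_ge0 ?w0 //; have := qs i iA; case: ifP => [ga|_ /ltW //].
move: no; rewrite negb_exists => /forallP/(_ i).
by rewrite iS (next_gap _ yA ya ymin) ga.
Qed.

End Triangulations.

(** * Flips *)

Section Flips.
Variables (R : realType) (N d : nat) (t : 'I_N -> R).
Hypothesis t_incr : forall i j : 'I_N, (i < j)%N -> t i < t j.
Hypothesis d_gt0 : (0 < d)%N.
Implicit Types (x y z i j : 'I_N) (A B D S U X Z : {set 'I_N}) (c w g : 'I_N -> R).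
Implicit Types (p q : {poly R}) (T : {set {set 'I_N}}).

Local Notation same_moments := (same_moments d t).
Local Notation dependency := (dependency d t).
Local Notation tri := (tri d t).

(** Add to [w] the largest multiple of the circuit that keeps all weights
    nonnegative; the weights that vanish are those at which the ratio is
    smallest. *)
Lemma circuit_shift A B w c b : cross d A B -> dependency c -> supported c (A :|: B) ->
  (forall a, a \in A -> 0 < c a) -> (forall b, b \in B -> c b < 0) ->
  (forall i, 0 <= w i) -> supported w (A :|: B) ->
  b \in B -> (forall b', b' \in B -> w b / - c b <= w b' / - c b') ->
  exists w', [/\ supported w' ((A :|: B) :\ b), same_moments w' w,
    forall i, 0 <= w' i,
    0 < w b -> forall a, a \in A -> 0 < w' a &
    forall b', b' \in B -> w b / - c b < w b' / - c b' -> 0 < w' b'].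
Proof.
move=> cAB dc sc cA cB w0 sw bB bmin; set l := w b / - c b.
have ncB b' : b' \in B -> 0 < - c b' by move=> h; rewrite oppr_gt0 cB.
have l0 : 0 <= l by rewrite /l divr_ge0 // ltW // ncB.
have shift b' : b' \in B -> w b' + l * c b' = (w b' / - c b' - l) * - c b'.
  by move=> b'B; rewrite mulrBl mulfVK ?mulrN ?opprK // gt_eqF // ncB.
exists (fun i => w i + l * c i); split.
- move=> i; rewrite !inE negb_and negbK => /orP[/eqP ->|iU].
    by rewrite shift // subrr mul0r.
  by rewrite sw ?sc ?mulr0 ?addr0 // !inE.
- exact: dep_same_moments.
- move=> i; have [iA|iA] := boolP (i \in A); first by rewrite addr_ge0 // mulr_ge0 // ltW // cA.
  have [iB|iB] := boolP (i \in B).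
    by rewrite shift // mulr_ge0 ?subr_ge0 ?bmin // ltW // ncB.
  by rewrite sc ?mulr0 ?addr0 // !inE negb_or iA.
- move=> wb a aA; rewrite ltr_wpDl // mulr_gt0 ?cA // divr_gt0 // ncB //.
- by move=> b' b'B h; rewrite shift // mulr_gt0 ?ncB // subr_gt0.
Qed.

(** In particular the facets opposite to [B] cover the projection of the whole
    simplex on [A :|: B]. *)
Lemma circuit_cover A B w : cross d A B -> (forall i, 0 <= w i) -> supported w (A :|: B) ->
  exists b w', [/\ b \in B, supported w' ((A :|: B) :\ b), forall i, 0 <= w' i &
    same_moments w' w].
Proof.
move=> cAB w0 sw; have [c [dc sc cA cB]] := circuit_exists t_incr d_gt0 cAB.
have : (0 < #|B|)%N by case: (cross_card cAB) => _ ->.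
case/card_gt0P => b0 b0B.
have [b bB bmin] := arg_minP (fun b => w b / - c b) b0B.
have [w' [h1 h2 h3 _ _]] := circuit_shift cAB dc sc cA cB w0 sw bB bmin.
by exists b, w'.
Qed.

(** The difference of the two weights would be a dependency with both signs
    on [A]. *)
Lemma circuit_faces_disjoint A B a b w w' : cross d A B -> a \in A -> b \in A ->
  positive_on ((A :|: B) :\ a) w -> positive_on ((A :|: B) :\ b) w' ->
  same_moments w w' -> a = b.
Proof.
move=> cAB aA bA [sw pw] [sw' pw'] ww'; apply/eqP/negPn/negP => ab.
have dc := same_moments_dep ww'.
have wa : w a = 0 by rewrite sw // !inE eqxx.
have wb : w' b = 0 by rewrite sw' // !inE eqxx.
have pa : 0 < w' a by rewrite pw' // !inE ab aA.
have pb : 0 < w b by rewrite pw // !inE eq_sym ab bA.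
case: (circuit_signs t_incr d_gt0 cAB dc).
- move=> i iU; have h (k : 'I_N) : i \notin (A :|: B) :\ k by apply: contraNN iU; rewrite
  inE => /andP[].
  by rewrite sw ?sw' ?subrr.
- by exists a; rewrite wa sub0r oppr_eq0 gt_eqF.
- by case=> h _; have := h _ aA; rewrite wa sub0r oppr_gt0 ltNge ltW.
- by case=> h _; have := h _ bA; rewrite wb subr0 ltNge ltW.
Qed.

(** The simplex on [A :|: B] has dimension one more than the polytope; its
    facets opposite to [B] are exchanged for its facets opposite to [A]. *)
Definition flip T A B : {set {set 'I_N}} :=
  [set S in T | ~~ (S \subset A :|: B)] :|: [set (A :|: B) :\ a | a in A].

(** Both sets of facets of the simplex on [A :|: B] cover the same points. A new
    simplex is disjoint from an old one that stays, because a common inner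
    point, moved slightly, would also be interior to one of the simplices that
    are replaced. *)
Lemma flip_tri A B T : cross d A B -> tri T ->
  (forall b, b \in B -> (A :|: B) :\ b \in T) -> tri (flip T A B).
Proof.
move=> cAB triT TB; have cU := cross_cardU d_gt0 cAB.
have AB := cross_disj d_gt0 cAB.
have new_old a S w w' : a \in A -> S \in T -> positive_on ((A :|: B) :\ a) w ->
   positive_on S w' -> same_moments w w' -> S \subset A :|: B.
  move=> aA ST [sw pw] pS ww'; have [c [dc sc cA cB]] := circuit_exists t_incr d_gt0 cAB.
  have wB b : b \in B -> 0 < w b.
    move=> bB; rewrite pw // !inE bB orbT andbT.
    by apply: contraTneq bB => ->; apply: AB.
  have w0 i : 0 <= w i.
    by have [/pw/ltW|/sw ->] := boolP (i \in (A :|: B) :\ a).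
  have swU : supported w (A :|: B).
    by move=> i iU; apply: sw; apply: contraNN iU; rewrite inE => /andP[].
  have : (0 < #|B|)%N by case: (cross_card cAB) => _ ->.
  case/card_gt0P => b0 b0B.
  have [b bB bmin] := arg_minP (fun b => w b / - c b) b0B.
  (* Weights added on [B :\ b] make [b] the only place where the ratio of
     [circuit_shift] is smallest: the perturbed point is interior to the old
     simplex opposite to [b]. *)
  pose g i : R := (i \in B :\ b)%:R.
  have cS := tri_card triT ST.
  have [e e0 he] := small_perturbation w' (bary t S g); have {}he := he e e0 (lexx _).
  have pS' : positive_on S (fun i => 1 * w' i + e * bary t S g i).
    split=> [i iS|i iS]; last by rewrite mul1r he // pS.2.
    by rewrite pS.1 // bary_supp // !mulr0 addr0.
  pose w1 i := 1 * w i + e * g i.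
  have g0 i : 0 <= g i by [].
  have gb : g b = 0 by rewrite /g !inE eqxx.
  have gb' b' : b' \in B -> b' != b -> g b' = 1 by move=> h1 h2; rewrite /g !inE h1 h2.
  have w1b : w1 b = w b by rewrite /w1 gb mulr0 addr0 mul1r.
  have ncB b' : b' \in B -> 0 < - c b' by move=> h; rewrite oppr_gt0 cB.
  have strict b' : b' \in B -> b' != b -> w1 b / - c b < w1 b' / - c b'.
    move=> b'B nb; rewrite w1b; apply: le_lt_trans (bmin _ b'B) _.
    by rewrite ltr_pM2r ?invr_gt0 ?ncB // /w1 gb' // mulr1 mul1r ltrDl.
  have w10 i : 0 <= w1 i by rewrite /w1 mul1r addr_ge0 // mulr_ge0 // ltW.
  have sw1 : supported w1 (A :|: B).
    move=> i iU; rewrite /w1 swU // mulr0 add0r /g.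
    by rewrite (negbTE (_ : i \notin _)) ?mulr0 //; apply: contraNN iU; rewrite !inE =>
      /andP[_ ->]; rewrite orbT.
  have min1 b' : b' \in B -> w1 b / - c b <= w1 b' / - c b'.
    by move=> b'B; have [->//|nb] := eqVneq b' b; apply: ltW; apply: strict.
  have [w2 [sw2 mw2 w20 pA pB]] := circuit_shift cAB dc sc cA cB w10 sw1 bB min1.
  have p2 : positive_on ((A :|: B) :\ b) w2.
    split=> // i; rewrite !inE => /andP[ib /orP[iA|iB]]; first by rewrite pA // w1b wB.
    by rewrite pB // strict.
  have m2 : same_moments w2 (fun i => 1 * w' i + e * bary t S g i).
    apply: same_moments_trans mw2 _; apply: same_moments_lin => //.
    exact: same_moments_sym (bary_moments t_incr g cS).
  by rewrite -(tri_disj triT (TB b bB) ST p2 pS' m2) subD1set.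
split.
- move=> S; rewrite !inE => /orP[/andP[ST _]|/imsetP[a aA ->]]; first by rewrite
  (tri_card triT ST).
  by move: cU; rewrite (cardsD1 a) inE aA add1n => -[].
- move=> S S' w w'; rewrite !inE.
  move=> /orP[/andP[ST SU]|/imsetP[a aA ->]] /orP[/andP[S'T S'U]|/imsetP[a' a'A ->]] pw pw' ww'.
  + exact: (tri_disj triT ST S'T pw pw' ww').
  + by case/negP: SU; apply: (new_old a' S w' w) => //; apply: same_moments_sym.
  + by case/negP: S'U; apply: (new_old a S' w w').
  + by rewrite (circuit_faces_disjoint cAB aA a'A pw pw' ww').
move=> g g0 gs; have [S [w [ST sw w0 wg]]] := tri_cover triT g0 gs.
have [SU|SU] := boolP (S \subset A :|: B); last first.
  by exists S, w; split=> //; rewrite !inE ST SU.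
have swU : supported w (B :|: A).
  by move=> i iU; apply: sw; apply: contraNN iU => /(subsetP SU); rewrite setUC.
have [a [w' [aA sw' w'0 mw']]] := circuit_cover (cross_sym d_gt0 cAB) w0 swU.
exists ((A :|: B) :\ a), w'; split=> //.
- by rewrite !inE; apply/orP; right; apply/imsetP; exists a.
- by rewrite setUC.
- exact: same_moments_trans mw' wg.
Qed.

(** All simplices containing [A] have their vertices in [A :|: B], where [B]
    collects the vertices in the gaps. The one found in the direction of the sum
    of [B :\ b] is opposite to [b]: if it were opposite to another [b'], the
    difference of the two weights would be a dependency with both signs on
    [B]. *)
Lemma single_vertices_flip T A S0 : tri T -> S0 \in T -> A \subset S0 -> #|A| = d.+1 ->
  (forall a, a \in A -> exists z, gap A a z) ->
  (forall a u u' S S', a \in A -> gap A a u -> gap A a u' -> S \in T -> S' \in T ->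
     A \subset S -> A \subset S' -> u \in S -> u' \in S' -> u = u') ->
  exists2 B, cross d A B & forall b, b \in B -> (A :|: B) :\ b \in T.
Proof.
move=> triT S0T AS0 cA gapA uniqA.
pose ray a u := gap A a u && [exists S in T, (A \subset S) && (u \in S)].
pose f a := odflt a [pick u | ray a u].
have fP a : a \in A -> ray a (f a).
  move=> aA; rewrite /f; case: pickP => [//|no]; have [z gz] := gapA a aA.
  have [u gu [S [ST AS uS]]] := gap_vertex t_incr d_gt0 triT S0T AS0 cA aA gz.
  by have := no u; rewrite /ray gu /= => /existsP[]; exists S; rewrite ST AS uS.
pose B := [set f a | a in A].
have cAB : cross d A B by apply: crossE => // a /fP/andP[].
have AB := cross_disj d_gt0 cAB; have cU := cross_cardU d_gt0 cAB.
have SU S : S \in T -> A \subset S -> S \subset A :|: B.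
  move=> ST AS; apply/subsetP => u uS; rewrite inE.
  have [//|uA /=] := boolP (u \in A).
  have A0 : (0 < #|A|)%N by rewrite cA.
  have [a aA ga] := gap_exists A0 uA.
  have /andP[gf /existsP[S' /and3P[S'T AS' fS']]] := fP a aA.
  by rewrite (uniqA a u (f a) S S') // imset_f.
exists B => // b bB.
pose g i : R := (i \in B :\ b)%:R.
have [S [w [ST AS sw w0 wg]]] := star_complete t_incr d_gt0 triT S0T AS0 cA (g := g) (fun
  i => ler0n _ _).
have cS := tri_card triT ST; have SU' := SU S ST AS.
suff SE : S = (A :|: B) :\ b by rewrite -SE.
apply/eqP; rewrite eqEcard subsetD1 SU' /=.
have -> : #|(A :|: B) :\ b| = #|S|.
  by have := cardsD1 b (A :|: B); rewrite inE bB orbT cU cS add1n => -[->].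
rewrite leqnn andbT; apply/negP => bS.
have /card_gt0P[b'] : (0 < #|(A :|: B) :\: S|)%N.
  by rewrite cardsD (setIidPr SU') cU cS; lia.
rewrite inE => /andP[b'S]; rewrite inE => /orP[b'A|b'B].
  by case/negP: b'S; apply: (subsetP AS).
have bb' : b' != b by apply: contraNneq b'S => ->.
have dc := same_moments_dep wg.
have cb' : w b' - g b' = -1 by rewrite sw // /g !inE bb' b'B sub0r.
have cb : 0 <= w b - g b.
  rewrite /g !inE eqxx subr0 w0 //; apply: contraTN bB; exact: AB.
case: (circuit_signs t_incr d_gt0 cAB dc).
- move=> i iU; rewrite sw; last by apply: contraNN iU; apply: subsetP.
  by rewrite /g (negbTE (_ : i \notin _)) ?subrr //; apply: contraNN iU; rewrite !inE =>
    /andP[_ ->]; rewrite orbT.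
- by exists b'; rewrite cb' oppr_eq0 oner_eq0.
- by case=> _ h; have := h _ bB; rewrite ltNge cb.
- by case=> _ h; have := h _ b'B; rewrite cb' ltNge oppr_le0 ler01.
Qed.

End Flips.

(** * Points, interiors and facets of the cyclic polytope *)

Section Geometry.
Variables (R : realType) (N d : nat) (t : 'I_N -> R).
Hypothesis t_incr : forall i j : 'I_N, (i < j)%N -> t i < t j.
Hypothesis d_gt0 : (0 < d)%N.
Hypothesis N_gt : ((2 * d).+1 <= N)%N.
Implicit Types (i k : 'I_N) (j : 'I_(2 * d)) (A B D S U X Z : {set 'I_N}) (c w g : 'I_N -> R).
Implicit Types (p q : {poly R}) (T : {set {set 'I_N}}) (x y : 'rV[R]_(2 * d)).

Local Notation same_moments := (same_moments d t).
Local Notation dependency := (dependency d t).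
Local Notation tri := (tri d t).

Definition barycenter w : 'rV[R]_(2 * d) := \sum_i w i *: moment_point d (t i).

Lemma barycenterE w j : barycenter w 0 j = \sum_i w i * t i ^+ j.+1.
Proof. by rewrite /barycenter summxE; apply: eq_bigr => i _; rewrite !mxE. Qed.

(** The affine functional on the space of the moment curve that restricts to
    [q] along the curve. *)
Definition affine q x : R := q`_0 + \sum_(j < 2 * d) q`_j.+1 * x 0 j.

Lemma evE w q : (size q <= (2 * d).+1)%N ->
  ev t w q = \sum_(k < (2 * d).+1) q`_k * \sum_i w i * t i ^+ k.
Proof.
move=> sq; rewrite /ev.
under eq_bigr => i _ do rewrite (horner_coef_wide _ sq) big_distrr /=.
rewrite exchange_big; apply: eq_bigr => k _; rewrite big_distrr /=.
by apply: eq_bigr => i _; rewrite mulrCA.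
Qed.

Lemma affine_barycenter w q : (size q <= (2 * d).+1)%N -> \sum_i w i = 1 ->
  affine q (barycenter w) = ev t w q.
Proof.
move=> sq w1; rewrite evE // big_ord_recl /affine.
under [X in _ = _ * X + _]eq_bigr => i _ do rewrite expr0 mulr1.
rewrite w1 mulr1; congr (_ + _); apply: eq_bigr => j _.
by rewrite barycenterE.
Qed.

Lemma ev1 w : ev t w 1 = \sum_i w i.
Proof. by rewrite /ev; apply: eq_bigr => i _; rewrite hornerE mulr1. Qed.

Lemma same_moments_barycenter w w' : \sum_i w i = 1 -> \sum_i w' i = 1 ->
  same_moments w w' <-> barycenter w = barycenter w'.
Proof.
move=> w1 w'1; split=> [h|h q sq]; last by rewrite -!affine_barycenter // h.
apply/rowP => j; have := h ('X^(j.+1)); rewrite size_polyXn ltnS ltn_ord => /(_ isT).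
rewrite /ev !barycenterE.
under eq_bigr => i _ do rewrite hornerXn.
by under [X in _ = X]eq_bigr => i _ do rewrite hornerXn.
Qed.

Lemma affine_sum (P : pred 'I_N) (a : 'I_N -> R) (q : 'I_N -> {poly R}) x :
  affine (\sum_(i | P i) a i *: q i) x = \sum_(i | P i) a i * affine (q i) x.
Proof.
rewrite /affine coef_sum.
under [X in _ + X = _]eq_bigr => j _.
  rewrite coef_sum big_distrl /=; under eq_bigr => i _ do rewrite coefZ.
over.
rewrite exchange_big -big_split; apply: eq_bigr => i _ /=.
rewrite coefZ mulrDr big_distrr; congr (_ + _).
by apply: eq_bigr => j _; rewrite /= mulrA.
Qed.

Definition coords S x i : R := if i \in S then affine (basis_poly t S i) x else 0.

Lemma coords_supp S x : supported (coords S x) S.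
Proof. by move=> i iS; rewrite /coords (negbTE iS). Qed.

Lemma ev_coords S x q : #|S| = (2 * d).+1 -> (size q <= (2 * d).+1)%N ->
  ev t (coords S x) q = affine q x.
Proof.
move=> cS sq; rewrite (ev_supp _ _ (@coords_supp S x)).
rewrite [in RHS](@interpolation _ _ _ t_incr q S) ?cS // affine_sum.
by apply: eq_bigr => i iS; rewrite /coords iS mulrC.
Qed.

Lemma coords_sum S x : #|S| = (2 * d).+1 -> \sum_i coords S x i = 1.
Proof.
move=> cS; rewrite -ev1 ev_coords ?size_poly1 // /affine coef1 eqxx big1 ?addr0 //.
by move=> j _; rewrite coef1 mul0r.
Qed.

Lemma coords_barycenter S x : #|S| = (2 * d).+1 -> barycenter (coords S x) = x.
Proof.
move=> cS; apply/rowP => j; rewrite barycenterE.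
have sX : (size ('X^(j.+1) : {poly R}) <= (2 * d).+1)%N by rewrite size_polyXn ltnS.
have := ev_coords x cS sX; rewrite /ev.
under eq_bigr => i _ do rewrite hornerXn.
move=> ->; rewrite /affine coefXn add0r (bigD1 j) //= coefXn eqxx mul1r.
rewrite big1 ?addr0 // => k kj; rewrite coefXn eqSS.
by rewrite (negbTE (_ : (k : nat) != j)) ?mul0r.
Qed.

Lemma coords_uniq S w : #|S| = (2 * d).+1 -> supported w S -> \sum_i w i = 1 ->
  coords S (barycenter w) =1 w.
Proof.
move=> cS sw w1; apply: (moments_uniq t_incr cS) => //; last exact: coords_supp.
by apply/same_moments_barycenter; rewrite ?coords_sum // coords_barycenter.
Qed.

Lemma hull_coords S x : #|S| = (2 * d).+1 ->
  hull d t S x <-> forall i, i \in S -> 0 <= coords S x i.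
Proof.
move=> cS; split=> [[w [w0 ws w1 ->]] i iS|h]; first by rewrite coords_uniq.
exists (coords S x); split; [|exact: coords_supp|exact: coords_sum|].
  by move=> i; have [/h//|/coords_supp ->] := boolP (i \in S).
by rewrite -[LHS](coords_barycenter x cS).
Qed.

Lemma nbhs_rowP x (P : set 'rV[R]_(2 * d)) :
  nbhs x P <-> exists2 e, 0 < e & forall y, (forall j, `|x 0 j - y 0 j| < e) -> P y.
Proof.
split=> [/nbhs_ballP[e e0 he]|[e e0 he]].
  exists e => // y hy; apply: he; split => // i j; rewrite (ord1 i); exact: hy.
apply/nbhs_ballP; exists e => // y [_ hy]; apply: he => j; exact: hy.
Qed.

(** If a coordinate of an inner point is not positive, moving away from the
    corresponding vertex leaves the simplex at once. Conversely, positive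
    coordinates stay positive nearby, as they are affine functions. *)
Lemma interior_coords S x : #|S| = (2 * d).+1 ->
  interior (hull d t S) x <-> forall i, i \in S -> 0 < coords S x i.
Proof.
move=> cS; split.
  move=> /nbhs_rowP[e e0 he] i iS.
  pose v : 'rV[R]_(2 * d) := x - moment_point d (t i).
  have [e' e'0 he'] := small_perturbation (fun j : 'I_(2 * d) => e) (fun j => - `|v 0 j|).
  have {}he' j := he' e' e'0 (lexx _) j e0.
  have /he/(hull_coords _ cS)/(_ i iS) : forall j, `|x 0 j - (x + e' *: v) 0 j| < e.
    move=> j; rewrite !mxE opprD addNKr normrN normrM gtr0_norm //.
    by have := he' j; rewrite !mxE mulrN subr_gt0.
  pose w k : R := (1 + e') * coords S x k + (- e') * (k == i)%:R.
  have -> : x + e' *: v = barycenter w.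
    rewrite /v /barycenter /w; under [RHS]eq_bigr => k _ do rewrite scalerDl -!scalerA.
    rewrite big_split /= -!scaler_sumr -/(barycenter _) coords_barycenter //.
    rewrite (bigD1 i) //= eqxx scale1r big1 ?addr0; last first.
      by move=> k /negbTE ->; rewrite scale0r.
    by rewrite scalerBr scalerDl scale1r addrA scaleNr.
  rewrite coords_uniq //; last first.
  - rewrite /w big_split /= -!big_distrr /= coords_sum // mulr1 (bigD1 i) //= eqxx big1.
      by rewrite addr0 mulr1 addrK.
    by move=> k /negbTE ->.
  - move=> k kS; rewrite /w coords_supp // mulr0 add0r.
    by rewrite (negbTE (_ : k != i)) ?mulr0 //; apply: contraNneq kS => ->.
  rewrite /w eqxx mulr1 subr_ge0 => h; rewrite -(pmulr_rgt0 _ (_ : 0 < 1 + e')).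
    exact: lt_le_trans h.
  by rewrite addr_gt0.
move=> pos; pose L i : R := \sum_(j < 2 * d) `|(basis_poly t S i)`_j.+1|.
have [e e0 he] := small_perturbation (coords S x) (fun i => - L i).
apply/nbhs_rowP; exists e => // y hy; apply/hull_coords => // i iS.
have := he e e0 (lexx _) i (pos i iS); rewrite /coords iS mulrN subr_gt0 => h.
have : affine (basis_poly t S i) x - affine (basis_poly t S i) y <= e * L i.
  rewrite /affine opprD addrACA subrr add0r -sumrB /L big_distrr /=.
  apply: ler_sum => j _; rewrite -mulrBr; apply: le_trans (ler_norm _) _.
  by rewrite normrM mulrC ler_wpM2r // ltW.
by move: h; lra.
Qed.

Lemma scaled_sum a w : \sum_i a * w i = a * \sum_i w i.
Proof. by rewrite big_distrr. Qed.

Lemma moments_sum w w' : same_moments w w' -> \sum_i w i = \sum_i w' i.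
Proof. by move=> h; rewrite -!ev1 h // size_poly1. Qed.

Lemma same_moments_scale a w w' : same_moments w w' ->
  same_moments (fun i => a * w i) (fun i => a * w' i).
Proof.
move=> h; apply: same_moments_ext (same_moments_lin a 0 h h) => i;
  by rewrite mul0r addr0.
Qed.

Lemma interiors_meet S S' w w' : #|S| = (2 * d).+1 -> #|S'| = (2 * d).+1 ->
  positive_on S w -> positive_on S' w' -> same_moments w w' ->
  exists x, interior (hull d t S) x /\ interior (hull d t S') x.
Proof.
move=> cS cS' [sw pw] [sw' pw'] ww'; pose s := \sum_i w i.
have s0 : 0 < s.
  have /card_gt0P[i iS] : (0 < #|S|)%N by rewrite cS.
  rewrite /s (bigD1 i) //= ltr_pwDl ?pw //; apply: sumr_ge0 => k _.
  by have [/pw/ltW|/sw ->] := boolP (k \in S).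
pose v i := s^-1 * w i; pose v' i := s^-1 * w' i.
have v1 : \sum_i v i = 1 by rewrite scaled_sum mulVf // gt_eqF.
have v'1 : \sum_i v' i = 1 by rewrite scaled_sum -(moments_sum ww') mulVf // gt_eqF.
have vv' : barycenter v = barycenter v'.
  by apply/same_moments_barycenter => //; apply: same_moments_scale.
exists (barycenter v); split; apply/interior_coords => // i iS.
  rewrite coords_uniq // ?mulr_gt0 ?invr_gt0 ?pw // => k kS.
  by rewrite /v sw ?mulr0.
rewrite vv' coords_uniq // ?mulr_gt0 ?invr_gt0 ?pw' // => k kS.
by rewrite /v' sw' ?mulr0.
Qed.

Lemma hull_sub S S' : S \subset S' -> (hull d t S `<=` hull d t S')%classic.
Proof.
move=> SS' x [w [w0 ws w1 xE]]; exists w; split=> // i iS'; apply: ws.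
by apply: contraNN iS'; apply: subsetP.
Qed.

Lemma triangulation_tri T : triangulation d t T <-> tri T.
Proof.
split=> [[cT dT uT]|triT].
  split=> //.
    move=> S S' w w' ST S'T pw pw' ww'; apply/eqP/negPn/negP => SS'.
    have [x [xS xS']] := interiors_meet (cT _ ST) (cT _ S'T) pw pw' ww'.
    have : (interior (hull d t S) `&` interior (hull d t S'))%classic x by split.
    by rewrite dT.
  move=> g g0 s0; set s := \sum_i g i in s0.
  have g1 : \sum_i s^-1 * g i = 1 by rewrite scaled_sum mulVf // gt_eqF.
  have : cyclic_polytope d t (barycenter (fun i => s^-1 * g i)).
    exists (fun i => s^-1 * g i); split=> // i; last by rewrite inE.
    by rewrite mulr_ge0 // invr_ge0 ltW.
  move=> /uT[S ST [w [w0 ws w1 e]]].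
  exists S, (fun i => s * w i); split=> //.
  - by move=> i iS; rewrite ws ?mulr0.
  - by move=> i; rewrite mulr_ge0 // ltW.
  have : same_moments (fun i => s^-1 * g i) w by apply/same_moments_barycenter.
  move=> /(same_moments_scale s) /same_moments_sym; apply: same_moments_ext => // i.
  by rewrite mulrA mulfV ?mul1r // gt_eqF.
have cT := tri_card triT; split=> //.
  move=> S S' ST S'T SS'; apply/seteqP; split=> // x [xS xS'].
  case/negP: SS'; apply/eqP.
  have hS := cT _ ST; have hS' := cT _ S'T.
  apply: (tri_disj triT ST S'T (w := coords S x) (w' := coords S' x)).
  - by split; [apply: coords_supp|apply/interior_coords].
  - by split; [apply: coords_supp|apply/interior_coords].
  - by apply/same_moments_barycenter; rewrite ?coords_sum ?coords_barycenter.
move=> x; split=> [[w [w0 _ w1 ->]]|[S ST]]; last by apply: hull_sub; apply/subsetP.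
have [|S [v [ST sv v0 vw]]] := tri_cover triT w0; first by rewrite w1.
have v1 : \sum_i v i = 1 by rewrite (moments_sum vw).
exists S => //; exists v; split=> //.
by apply/esym/same_moments_barycenter.
Qed.

(** The polynomial on the moment curve of the affine function
    [b - \sum_j c 0 j * x 0 j]. *)
Definition row_poly (b : R) (c : 'rV[R]_(2 * d)) : {poly R} :=
  \poly_(k < (2 * d).+1) (if k is k'.+1 then - \sum_(j < 2 * d | j == k' :> nat) c 0 j else b).

Lemma row_poly_coef b (c : 'rV[R]_(2 * d)) (j : 'I_(2 * d)) : (row_poly b c)`_j.+1 = - c 0 j.
Proof.
rewrite coef_poly ltnS ltn_ord (bigD1 j) //= big1 ?addr0 // => k /andP[/eqP e].
by rewrite -val_eqE /= e eqxx.
Qed.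

Lemma affine_row_poly b (c x : 'rV[R]_(2 * d)) :
  affine (row_poly b c) x = b - \sum_j c 0 j * x 0 j.
Proof.
rewrite /affine coef_poly /= -sumrN; congr (_ + _).
by apply: eq_bigr => j _; rewrite row_poly_coef mulNr.
Qed.

Lemma size_row_poly b (c : 'rV[R]_(2 * d)) : (size (row_poly b c) <= (2 * d).+1)%N.
Proof. exact: size_poly. Qed.

Lemma barycenter_hull S w : (forall i, 0 <= w i) -> supported w S -> \sum_i w i = 1 ->
  hull d t S (barycenter w).
Proof. by move=> w0 sw w1; exists w. Qed.

Definition vertex i : 'rV[R]_(2 * d) := barycenter (fun k => (k == i)%:R).

Lemma sum_delta i : \sum_k (k == i)%:R = 1 :> R.
Proof. by rewrite (bigD1 i) //= eqxx big1 ?addr0 // => k /negbTE ->. Qed.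

Lemma vertex_hull S i : i \in S -> hull d t S (vertex i).
Proof.
move=> iS; apply: barycenter_hull; rewrite ?sum_delta // => k kS.
by rewrite (negbTE (_ : k != i)) //; apply: contraNneq kS => ->.
Qed.

Lemma affine_vertex q i : (size q <= (2 * d).+1)%N -> affine q (vertex i) = q.[t i].
Proof.
move=> sq; rewrite affine_barycenter ?sum_delta // /ev (bigD1 i) //= eqxx mul1r.
by rewrite big1 ?addr0 // => k /negbTE ->; rewrite mul0r.
Qed.

(** An affine inequality holds on the polytope when it holds at the vertices. *)
Lemma face_poly F : polytope_face (cyclic_polytope d t) F <->
  exists q, [/\ (size q <= (2 * d).+1)%N, forall i, 0 <= q.[t i] &
    forall x, F x <-> cyclic_polytope d t x /\ affine q x = 0].
Proof.
split=> [[c [b [bC FE]]]|[q [sq q0 FE]]].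
  exists (row_poly b c); split; first exact: size_row_poly.
    move=> i; rewrite -affine_vertex ?size_row_poly // affine_row_poly subr_ge0.
    by apply: bC; apply: vertex_hull; rewrite inE.
  move=> x; rewrite FE affine_row_poly; split=> -[h1 h2]; split=> //.
    by rewrite h2 subrr.
  by apply/esym/eqP; rewrite -subr_eq0 h2.
exists (\row_j - q`_j.+1), q`_0.
have rE x : \sum_j (\row_j - q`_j.+1) 0 j * x 0 j = q`_0 - affine q x.
  rewrite /affine opprD addrA subrr sub0r -sumrN; apply: eq_bigr => j _.
  by rewrite mxE mulNr.
split=> x; last first.
  rewrite FE rE; split=> -[h1 h2]; split=> //; first by rewrite h2 subr0.
  by move/eqP: h2; rewrite subr_eq addrC -subr_eq subrr => /eqP.
move=> [w [w0 _ w1 ->]]; rewrite rE gerBl affine_barycenter //.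
by apply: sumr_ge0 => i _; rewrite mulr_ge0.
Qed.

(** The polynomial of a face vanishing on one side of a circuit vanishes on
    the other, hence everywhere. *)
Lemma cross_not_in_facet A B F : cross d A B ->
  polytope_facet (cyclic_polytope d t) F -> ~ (hull d t A `<=` F)%classic.
Proof.
move=> cAB [/face_poly[q [sq q0 FE]] Fne _] AF.
have qA a : a \in A -> q.[t a] = 0.
  by move=> aA; have /AF/FE[_] := vertex_hull aA; rewrite affine_vertex.
have [c [dc sc cA cB]] := circuit_exists t_incr d_gt0 cAB.
have qB b : b \in B -> q.[t b] = 0.
  have le0 i : c i * q.[t i] <= 0.
    have [iA|iA] := boolP (i \in A); first by rewrite qA ?mulr0.
    have [iB|iB] := boolP (i \in B); first by rewrite mulr_le0_ge0 // ltW // cB.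
    by rewrite sc ?mul0r // inE negb_or iA.
  move=> bB; have /eqP := dc q sq; rewrite /ev -oppr_eq0 -sumrN psumr_eq0; last first.
    by move=> j _; rewrite oppr_ge0.
  move=> /allP/(_ b (mem_index_enum _))/=; rewrite oppr_eq0 mulf_eq0.
  by rewrite lt_eqF ?cB //= => /eqP.
have q00 : q = 0.
  apply: (poly_small0 t_incr (S := A :|: B)).
    by rewrite (cross_cardU d_gt0 cAB) ltnW.
  by move=> i; rewrite inE => /orP[/qA|/qB].
apply: Fne; apply/seteqP; split=> x; first by case/FE.
move=> xC; apply/FE; split=> //; rewrite q00 /affine coef0 add0r big1 // => j _.
by rewrite coef0 mul0r.
Qed.

Lemma face_hull q F : (size q <= (2 * d).+1)%N -> (forall i, 0 <= q.[t i]) ->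
  (forall x, F x <-> cyclic_polytope d t x /\ affine q x = 0) ->
  forall x, F x <-> hull d t [set i | q.[t i] == 0] x.
Proof.
move=> sq q0 FE x; split; last first.
  move=> [w [w0 ws w1 ->]]; apply/FE; split; first by exists w; split=> // i; rewrite inE.
  rewrite affine_barycenter // /ev big1 // => i _.
  have [/eqP ->|/eqP h] := boolP (q.[t i] == 0); first by rewrite mulr0.
  by rewrite ws ?mul0r // inE; apply/eqP.
move=> /FE[[w [w0 _ w1 ->]]]; rewrite affine_barycenter // => /eqP.
rewrite /ev psumr_eq0; last by move=> i _; rewrite mulr_ge0.
move=> /allP h; exists w; split=> // i; rewrite inE => qi.
by have := h i (mem_index_enum _); rewrite /= mulf_eq0 (negbTE qi) orbF => /eqP.
Qed.

(** A face is the hull of the vertices where its polynomial vanishes, so a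
    proper face containing [A] with a maximal set of vertices is a facet. *)
Lemma in_facet_poly A q : (size q <= (2 * d).+1)%N -> (forall i, 0 <= q.[t i]) ->
  (exists i, q.[t i] != 0) -> (forall a, a \in A -> q.[t a] = 0) ->
  exists F, polytope_facet (cyclic_polytope d t) F /\ (hull d t A `<=` F)%classic.
Proof.
move=> sq q0 qne qA.
pose P := fun W : {set 'I_N} => [exists i, i \notin W] && `[< exists q : {poly R}, [/\
  (size q <= (2 * d).+1)%N,
  forall i, 0 <= q.[t i] & W = [set i | q.[t i] == 0]] >].
have PW : P [set i | q.[t i] == 0].
  apply/andP; split; last by apply/asboolP; exists q.
  by case: qne => i qi; apply/existsP; exists i; rewrite inE.
have [W /maxsetP[/andP[/existsP[i0 i0W] /asboolP[r [sr r0 WE]]] maxW] subW] :=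
  @maxset_exists _ P _ PW.
have FH := face_hull sr r0 (fun x => iff_refl (cyclic_polytope d t x /\ affine r x = 0)).
exists (fun x => cyclic_polytope d t x /\ affine r x = 0); split; last first.
  move=> x [w [w0 ws w1 ->]].
  have sw : supported w W.
    by move=> i iW; apply: ws; apply: contraNN iW => /qA e; apply: (subsetP subW);
      rewrite inE e.
  by apply/FH; rewrite -WE; exists w.
split.
- by apply/face_poly; exists r.
- move=> e; have : cyclic_polytope d t (vertex i0) by apply: vertex_hull; rewrite inE.
  by rewrite -{1}e affine_vertex // => -[_ /eqP]; apply/negP; move: i0W; rewrite WE inE.
move=> G /face_poly[s [ss s0 GE]] Gne sub.
have GW : [set i | s.[t i] == 0] = W.
  apply: maxW; last first.
    apply/subsetP => i; rewrite WE !inE => /eqP ri.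
    have /sub/GE[_] : cyclic_polytope d t (vertex i) /\ affine r (vertex i) = 0.
      by split; [apply: vertex_hull; rewrite inE|rewrite affine_vertex].
    by rewrite affine_vertex // => ->.
  apply/andP; split; last by apply/asboolP; exists s.
  have [//|] := boolP [exists i, i \notin [set i | s.[t i] == 0]].
  rewrite negb_exists => /forallP no; case: Gne.
  apply/seteqP; split=> x; first by case/GE.
  move=> [w [w0 _ w1 ->]]; apply/(face_hull ss s0 GE); exists w; split=> // i iW.
  by have := no i; rewrite iW.
apply/seteqP; split=> x.
  by move=> /(face_hull ss s0 GE); rewrite GW WE => /FH.
by move=> /FH h; apply/(face_hull ss s0 GE); rewrite GW WE.
Qed.

(** The gap between the two adjacent elements is empty, so that the polynomial
    of this gap is nonnegative at all parameters. *)
Lemma adjacent_in_facet A a : #|A| = d.+1 -> a \in A -> ordS a \in A ->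
  exists F, polytope_facet (cyclic_polytope d t) F /\ (hull d t A `<=` F)%classic.
Proof.
move=> cA aA sA; have N1 : (1 < N)%N by lia.
have aS : a != ordS a by rewrite eq_sym ordS_neq.
have [q sq [qA qn]] := between_poly t_incr d_gt0 cA aA sA aS.
have qpos i : i \notin A -> 0 < q.[t i].
  move=> iA; have := qn i iA; rewrite /between.
  rewrite dist_succ //.
  by case: ifP => //; lia.
apply: (@in_facet_poly A q) => //.
  by move=> i; have [/qA ->|/qpos/ltW] := boolP (i \in A).
have : (0 < #|~: A|)%N by have := cardsC A; rewrite card_ord cA; lia.
by case/card_gt0P => i; rewrite inE => iA; exists i; rewrite gt_eqF ?qpos.
Qed.

Definition spread D := [forall i in D, ordS i \notin D].

(** A set without adjacent elements crosses its own shift by one; by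
    [cross_not_in_facet] it is then contained in no facet. *)
Lemma spread_cross D : #|D| = d.+1 -> spread D -> cross d D [set ordS i | i in D].
Proof.
move=> cD /forall_inP sD; apply: crossE => // i iD; apply/gapP => j jD ji.
have N1 : (1 < N)%N by lia.
have : dist i j != 1%N.
  by apply: contraNneq (sD i iD) => e; rewrite (_ : ordS i = j) //; apply: (@dist_inj _
    i); rewrite e dist_succ.
have ij : i != j by rewrite eq_sym.
by have := dist_gt0 ij; rewrite /between dist_succ //=; lia.
Qed.

Lemma d_arcsP T D : D \in d_arcs d t T <->
  [/\ #|D| = d.+1, exists2 S, S \in T & D \subset S & spread D].
Proof.
rewrite inE asboolE; split=> -[cD sD h]; split=> //.
  apply/forall_inP => i iD; apply/negP => siD; apply: h.
  exact: adjacent_in_facet cD iD siD.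
by move=> [F [fF]]; apply: cross_not_in_facet fF; apply: spread_cross.
Qed.

Lemma cross_d_arc T D Z S : cross d D Z -> S \in T -> D \subset S -> D \in d_arcs d t T.
Proof.
move=> cDZ ST DS; rewrite inE; apply/asboolP; split.
- by case: cDZ.
- by exists S.
- by move=> [F [fF]]; apply: (cross_not_in_facet cDZ fF).
Qed.

End Geometry.

(** * Moves and retrograde pairs *)

Section Quiver.
Variables (N d : nat).
Hypothesis d_gt0 : (0 < d)%N.
Implicit Types (p u v w x y z l : 'I_N) (A B C D X Y Z : {set 'I_N}).

Definition move X x y : {set 'I_N} := y |: (X :\ x).

Lemma in_move X x y z : (z \in move X x y) = (z == y) || ((z != x) && (z \in X)).
Proof. by rewrite !inE. Qed.

Lemma move_card X x y : x \in X -> y \notin X -> #|move X x y| = #|X|.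
Proof.
by move=> xX yX; rewrite /move cardsU1 !inE (negbTE yX) andbF (cardsD1 x X) xX.
Qed.

Lemma imset_all (a : 'I_d.+1 -> 'I_N) i : a i \in [set a j | j : 'I_d.+1].
Proof. by apply/imsetP; exists i. Qed.

Lemma imset_add_entry (a : 'I_d.+1 -> 'I_N) i r : injective a ->
  [set add_entry a i r j | j : 'I_d.+1] =
    move [set a j | j : 'I_d.+1] (a i) (iter r (@ordS N) (a i)).
Proof.
move=> ainj; apply/setP => z; rewrite in_move; apply/imsetP/orP.
  move=> [j _ ->]; rewrite /add_entry; have [->|ji] := eqVneq j i; first by left.
  by right; rewrite imset_all andbT; apply: contraNneq ji => /ainj ->.
case=> [/eqP ->|/andP[zi /imsetP[j _ zj]]].
  by exists i; rewrite // /add_entry eqxx.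
exists j; rewrite // /add_entry ifN //.
by apply: contraNneq zi => <-; rewrite zj.
Qed.

Lemma inj_add_entry (a : 'I_d.+1 -> 'I_N) i r : injective a ->
  iter r (@ordS N) (a i) \notin [set a j | j : 'I_d.+1] -> injective (add_entry a i r).
Proof.
move=> ainj out j k; rewrite /add_entry.
have [->|_] := eqVneq j i; have [->|_] := eqVneq k i => // e; last exact: ainj.
  by case/negP: out; rewrite e imset_all.
by case/negP: out; rewrite -e imset_all.
Qed.

Lemma inj_incr l (a : 'I_d.+1 -> 'I_N) :
  (forall i j : 'I_d.+1, (i < j)%N -> (dist l (a i) < dist l (a j))%N) -> injective a.
Proof.
move=> mono i j e; apply/val_inj => /=; case: (ltngtP i j) => // /mono;
  by rewrite e ltnn.
Qed.

Lemma enum_from X x : #|X| = d.+1 -> x \in X ->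
  exists e : 'I_d.+1 -> 'I_N, [/\ X = [set e i | i : 'I_d.+1], e ord0 = x &
    forall i j : 'I_d.+1, (i < j)%N -> (dist x (e i) < dist x (e j))%N].
Proof.
move=> cX xX; pose r : rel 'I_N := fun y z => (dist x y <= dist x z)%N.
have rtot : total r by move=> y z; apply: leq_total.
have rtr : transitive r by move=> y z w; apply: leq_trans.
set s := sort r (enum X); have ss : size s = d.+1 by rewrite size_sort -cardE.
have su : uniq s by rewrite sort_uniq enum_uniq.
have smem z : (z \in s) = (z \in X) by rewrite mem_sort mem_enum.
have mono (i j : 'I_d.+1) : (i < j)%N -> (dist x (nth x s i) < dist x (nth x s j))%N.
  move=> ij; rewrite ltn_neqAle; apply/andP; split.
    by apply/eqP => /dist_inj/eqP; rewrite nth_uniq ?ss // ltn_eqF.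
  by apply: (sorted_ltn_nth rtr x (sort_sorted rtot _)); rewrite ?inE ?ss.
have sE : X = [set nth x s i | i : 'I_d.+1].
  apply/setP => z; apply/idP/imsetP => [zX|[i _ ->]]; last by rewrite -smem mem_nth ?ss.
  have zs : (index z s < d.+1)%N by rewrite -ss index_mem smem.
  by exists (Ordinal zs); rewrite //= nth_index // smem.
exists (fun i => nth x s i); split=> //.
have := xX; rewrite sE => /imsetP[k _ ek].
have [k0|k0] := posnP k; first by rewrite [RHS]ek k0.
by have := mono ord0 k k0; rewrite -ek distxx.
Qed.

(** Cyclic indices follow the cyclic order, including from the last to the first. *)
Lemma enum_next l (a : 'I_d.+1 -> 'I_N) i j :
  (forall i j : 'I_d.+1, (i < j)%N -> (dist l (a i) < dist l (a j))%N) -> j != i ->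
  (dist (a i) (a (ordS i)) <= dist (a i) (a j))%N.
Proof.
move=> mono ji; have mono_le (k k' : 'I_d.+1) : (k <= k')%N -> (dist l (a k) <= dist l (a
  k'))%N.
  by rewrite leq_eqVlt => /orP[/eqP/val_inj ->//|/mono/ltnW].
rewrite !(dist_base l (a i)); have := dist_lt l (a i); have := dist_lt l (a j).
have [id|id] := eqVneq (i : nat) d.
  have jlt : (j < i)%N.
    have jd : (j <= i)%N by rewrite id -ltnS ltn_ord.
    move: jd; rewrite leq_eqVlt => /orP[/eqP/val_inj e|//].
    by rewrite e eqxx in ji.
  have := mono_le (ordS i) j; rewrite /= id modnn => /(_ isT); have := mono _ _ jlt.
  move: (dist l (a i)) (dist l (a j)) (dist l (a (ordS i))) => u v w; clear.
  by repeat (case: ifP); lia.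
have iv : ordS i = i.+1 :> nat.
  by rewrite /= modn_small // ltnS ltn_neqAle id -ltnS ltn_ord.
have ilt : (i < ordS i)%N by rewrite iv.
have := mono _ _ ilt; case: (ltngtP i j) => [ij|ij|/val_inj e]; last by rewrite e eqxx in ji.
  have h : (ordS i <= j)%N by rewrite iv.
  have := mono_le _ _ h.
  move: (dist l (a i)) (dist l (a j)) (dist l (a (ordS i))) => u v w; clear.
  by repeat (case: ifP); lia.
have := mono _ _ ij; have := dist_lt l (a (ordS i)).
move: (dist l (a i)) (dist l (a j)) (dist l (a (ordS i))) => u v w; clear.
by repeat (case: ifP); lia.
Qed.

(** The index-free form of [retrograde_at], with [p] and [v] the entries of [C]
    that move. *)
Definition retro C A D p v y u :=
  [/\ #|C| = d.+1,
      [/\ p \in C, v \in C, v != p & forall z, z \in C -> z != p -> (dist p v <= dist p z)%N],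
      gap C v y /\ A = move C v y &
      between p v u /\ D = move A p u].

Lemma retrograde_atP C A D :
  retrograde_at d C A D <-> exists p v y u, retro C A D p v y u.
Proof.
split.
  move=> [a [i [r [s [[CE [l mono]] [r1 /cyclic_lt3P gy AE] [s1 DE] /cyclic_lt3P gu]]]]].
  have ainj := inj_incr mono; pose p := a (ord_pred i); pose v := a i.
  pose y := iter r (@ordS N) v; pose u := iter s (@ordS N) p.
  have pi : ord_pred i != i.
    apply/eqP => e; have d1 : (1 < d.+1)%N by [].
    by have := ordS_neq i d1; rewrite -{1}e ord_predK eqxx.
  have cC : #|C| = d.+1 by rewrite CE card_imset // card_ord.
  have vC : v \in C by rewrite CE imset_all.
  have gapC : gap C v y.
    apply/gapP => z; rewrite CE => /imsetP[j _ ->] ne.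
    have ji : j != i by apply: contraNneq ne => ->.
    move: gy; rewrite /between -/v -/y => /andP[-> h] /=.
    exact: leq_trans h (enum_next mono ji).
  have yC := gap_notin (card_gt1 d_gt0 cC) vC gapC.
  have AM : A = move C v y by rewrite AE imset_add_entry // -CE.
  exists p, v, y, u; split=> //; last first.
    split=> //; rewrite DE imset_add_entry ?imset_add_entry // -?CE.
      by rewrite -/v -/y -AM {1 2}/add_entry (negbTE pi) -/p.
    by apply: inj_add_entry; rewrite // -CE.
  split=> //; first by rewrite CE imset_all.
    by rewrite /v /p; apply: contraNneq pi => /ainj e; rewrite -e.
  move=> z; rewrite CE => /imsetP[j _ ->] ne.
  have ji : j != ord_pred i by apply: contraNneq ne => ->.
  by have := enum_next mono ji; rewrite ord_predK.
move=> [p [v [y [u [cC [pC vC vp pmin] [gy AE] [gu DE]]]]]].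
have [e [CE e0 mono]] := enum_from cC vC; have einj := inj_incr mono.
have yE : iter (dist v y) (@ordS N) v = y := iter_ordS_dist v y.
have uE : iter (dist p u) (@ordS N) p = u := iter_ordS_dist p u.
have yC := gap_notin (card_gt1 d_gt0 cC) vC gy.
have po : ord_pred (ord0 : 'I_d.+1) = ord_max.
  by apply/val_inj => /=; rewrite modn_small.
have max0 : ord_max != ord0 :> 'I_d.+1 by rewrite -val_eqE /= -lt0n.
have pmax : e ord_max = p.
  move: (pC); rewrite {1}CE => /imsetP[k _ pk]; rewrite pk; congr e.
  apply/val_inj => /=; apply/eqP; rewrite eq_sym eqn_leq -ltnS ltn_ord /= leqNgt;
    apply/negP => kd.
  have h := mono k ord_max kd; rewrite -pk in h.
  have mC : e ord_max \in C by rewrite CE imset_all.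
  have mp : e ord_max != p by apply: contraTneq h => ->; rewrite ltnn.
  have := pmin _ mC mp; rewrite !(dist_base v p) distxx.
  have := dist_lt v p; have := dist_lt v (e ord_max); have := h.
  have : (0 < dist v p)%N by rewrite dist_gt0.
  by clear; repeat (case: ifP); lia.
exists e, ord0, (dist v y), (dist p u); split.
- by split=> //; exists v.
- have vy := between_neql gu; split.
  + have [z zC zv] := cross_sep d_gt0 v cC.
    by have /andP[] := gapP _ _ _ gy z zC zv.
  + rewrite e0 yE; apply/cyclic_lt3P; apply: (gapP _ _ _ gy).
      by rewrite CE imset_all.
    rewrite -e0; apply/eqP => /einj/(congr1 val) /=.
    by rewrite modn_small.
  + by rewrite AE imset_add_entry // -CE e0 yE.
- split; first by case/andP: gu.
  rewrite DE AE po imset_add_entry; last first.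
    by apply: inj_add_entry; rewrite // -CE e0 yE.
  rewrite imset_add_entry // -CE e0 yE /add_entry (negbTE max0) pmax uE.
  by [].
- by rewrite po pmax uE e0; apply/cyclic_lt3P.
Qed.

(** Counted from the predecessor of [x], the elements of [X] shifted down by one
    and those of [move X x v] alternate, starting with the pair of [x] and
    [v]. *)
Lemma move_intertwining X x v : #|X| = d.+1 -> x \in X -> gap X x v ->
  (forall z, z \in X -> ordS z \notin X) ->
  (forall z, z \in move X x v -> ordS z \notin move X x v) ->
  intertwining d (minus_one X) (move X x v).
Proof.
move=> cX xX gv sX sD.
have [e [XE e0 mono]] := enum_from cX xX; have einj := inj_incr mono.
have vE : iter (dist x v) (@ordS N) x = v := iter_ordS_dist x v.
have [z zX zx] := cross_sep d_gt0 x cX.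
have vgap (w : 'I_N) : w \in X -> w != x -> (dist x v < dist x w)%N.
  by move=> wX wx; case/andP: (gapP _ _ _ gv w wX wx).
have npred w : w \in X -> w != ord_pred x.
  by move=> wX; apply: contraTneq wX => ->; apply/negP => /sX; rewrite ord_predK xX.
have nv : v != ord_pred x.
  apply: contraTneq (vgap z zX zx) => ->; rewrite dist_pred_self -leqNgt.
  by have := dist_lt x z; lia.
have eX i : e i \in X by rewrite XE imset_all.
exists (ord_pred x), (fun i => ord_pred (e i)), (add_entry e ord0 (dist x v)); split.
- by rewrite /minus_one XE -imset_comp.
- by rewrite imset_add_entry // -XE e0 vE.
- move=> i; rewrite shift_ltE dist_pred2 /add_entry; case: eqP => [->|_].
    by rewrite e0 vE distxx dist_from_pred.
  by rewrite dist_from_pred ?npred.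
move=> i j ji; rewrite shift_ltE dist_pred2.
have ij : (i < j)%N by rewrite ji.
have j0 : e j != x.
  by rewrite -e0; apply/eqP => /einj ej; rewrite ej in ij.
rewrite /add_entry; case: eqP => [i0|_].
  rewrite i0 e0 vE dist_from_pred // ltn_neqAle vgap // andbT.
  apply/eqP => h; have ev : ordS v = e j by apply: (@dist_inj _ x); rewrite dist_ordS.
  by have := sD v; rewrite !in_move eqxx ev j0 eX orbT => /(_ isT).
rewrite dist_from_pred ?npred // ltn_neqAle mono // andbT.
apply/eqP => h; have ev : ordS (e i) = e j by apply: (@dist_inj _ x); rewrite dist_ordS
  // npred.
by have := sX (e i) (eX i); rewrite ev eX.
Qed.

End Quiver.

(** * Arrows and retrograde paths *)

Section Paths.
Variables (N d : nat).
Hypothesis d_gt0 : (0 < d)%N.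
Implicit Types (p u v w x y z l : 'I_N) (A B C D M X Y Z : {set 'I_N}).

(** The first hypothesis puts one element of [Y] in each half-open gap
    [[a, a' - 2]] of [X], the second one puts one element of [Y] in each interval
    [[c + 2, c']] given by consecutive elements [c], [c'] of [move X x v]. If
    [Y] is disjoint from [X], it crosses [X]. Otherwise the two partitions of
    the circle force [Y] to contain, with an element [a] of [X], its predecessor
    too; near [x] this reads: [Y] contains an element between [x] and [v]. *)
Lemma intermediate_move X x v Y : x \in X -> gap X x v ->
  cross d (minus_one X) Y -> cross d (minus_one Y) (move X x v) ->
  cross d X Y \/ exists w, Y = move X x w /\ (dist x w <= dist x v)%N.
Proof.
move=> xX gv c1 c2; have [cX cY] := cross_card c1.
rewrite card_imset in cX; last exact: ord_pred_inj.
have vlt w : w \in X -> w != x -> (dist x v < dist x w)%N.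
  by move=> wX wx; case/andP: (gapP _ _ _ gv w wX wx).
have pne (b a : 'I_N) : b != a -> ord_pred b != ord_pred a.
  by apply: contraNneq => /ord_pred_inj ->.
have btw1 b a : b \in X -> a \in X -> b != a ->
    exists2 z, z \in Y & ((dist b z).+1 < dist b a)%N.
  move=> bX aX ba; have [z zY] := cross_between c1 (imset_f _ bX) (imset_f _ aX) (pne _ _ ba).
  by rewrite between_pred2 // => h; exists z.
have btw2 b a : b \in Y -> a \in Y -> b != a ->
    exists2 z, z \in move X x v & ((dist b z).+1 < dist b a)%N.
  move=> bX aX ba; have [z zY] := cross_between c2 (imset_f _ bX) (imset_f _ aX) (pne _ _ ba).
  by rewrite between_pred2 // => h; exists z.
(* What [Y] contains near [a] when the two conditions are matched index by index. *)
pose good a := if a == x then [exists z in Y, (dist x z <= dist x v)%N] else a \in Y.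
have [/existsP[a0 /andP[a0X ga0]]|nogood] := boolP [exists a in X, good a]; last first.
  left; case: c1 => _ [f fE fP]; split=> //; exists (fun a => f (ord_pred a)).
    by rewrite fE -imset_comp.
  move=> a aX; apply/gapP => z zX za.
  have := gapP _ _ _ (fP _ (imset_f _ aX)) _ (imset_f _ zX) (pne _ _ za).
  rewrite between_pred2 1?eq_sym // => h; rewrite /between (ltnW h) andbT.
  apply: dist_gt0; apply: contraNneq nogood => e.
  apply/existsP; exists a; rewrite aX /good; have aY : a \in Y.
    by rewrite e fE imset_f // imset_f.
  case: eqP => // ax; apply/existsP; exists a; by rewrite aY ax distxx.
(* If [b] fails and its successor [a] does not, two elements of [Y] lie between
   the same consecutive elements of [move X x v]. *)
right; have allgood : forall b, b \in X -> good b.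
  apply: (@cyclic_propagate _ X good _ a0 a0X ga0) => b a bX aX ba noX ga.
  apply/negPn/negP => nb.
  have [z zY zlt] := btw1 b a bX aX ba.
  have noXc c : c \in X -> (dist b c < dist b a)%N -> c = b.
    move=> cX' cl; apply/eqP; rewrite eq_sym -dist_eq0 -leqn0 leqNgt; apply/negP => c0.
    by have := noX c cX'; rewrite /between c0 cl.
  have zb : b != x -> z != b.
    by move=> bx; apply: contraNneq nb => zb; rewrite /good (negbTE bx) -zb.
  move: ga; rewrite /good; have [ax|ax] := eqVneq a x.
    subst a; move=> /existsP[z2 /andP[z2Y z2v]].
    have vb := vlt b bX ba; have zb' := zb ba.
    have dz2 : (dist b z2 = dist b x + dist x z2)%N.
      move: z2v vb; rewrite !(dist_base b x) distxx.
      have := dist_lt b z2; have := dist_lt b v; have := dist_lt b x; have := dist_gt0 ba.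
      by clear; repeat (case: ifP); lia.
    have zz2 : z != z2.
      by apply: contraTneq zlt => ->; rewrite dz2 -leqNgt -addnS leq_addr.
    have [c cD clt] := btw2 z z2 zY z2Y zz2.
    have dc : (dist b c = dist b z + dist z c)%N /\ ((dist b c).+1 < dist b x + dist x z2)%N.
      move: clt zlt; rewrite -dz2 !(dist_base b z).
      have := dist_lt b z2; have := dist_lt b c; have := dist_lt b z; have := dz2.
      by clear; repeat (case: ifP); lia.
    case: dc => dc1 dc2; move: cD; rewrite in_move => /orP[/eqP cv|/andP[cx cX']].
      subst c; move: dc2 z2v vb; rewrite !(dist_base b x) distxx.
      have := dist_lt b z2; have := dist_lt b v; have := dist_lt b x; have := dist_gt0 ba.
      by clear; repeat (case: ifP); lia.
    have [cl|cl] := ltnP (dist b c) (dist b x).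
      have cb := noXc c cX' cl; move: dc1; rewrite cb distxx => /esym/eqP.
      by rewrite addn_eq0 dist_eq0 eq_sym (negbTE zb').
    have := vlt c cX' cx; move: cl dc2 z2v; rewrite (dist_base b x c).
    by have := dist_lt b c; clear; repeat (case: ifP); lia.
  move=> aY; have za : z != a by apply: contraTneq zlt => ->; rewrite -leqNgt leqnSn.
  have [c cD clt] := btw2 z a zY aY za.
  have [dc1 dc2] : (dist b c = dist b z + dist z c)%N /\ ((dist b c).+1 < dist b a)%N.
    move: clt zlt; rewrite !(dist_base b z).
    have := dist_lt b a; have := dist_lt b c; have := dist_lt b z.
    by clear; repeat (case: ifP); lia.
  move: cD; rewrite in_move => /orP[/eqP cv|/andP[cx cX']]; last first.
    have cb := noXc c cX' (ltnW dc2); rewrite -cb in zb.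
    move: dc1; rewrite -cb distxx => /esym/eqP.
    by rewrite addn_eq0 dist_eq0 eq_sym (negbTE (zb cx)).
  subst c; have [bx|bx] := eqVneq b x.
    subst b; case/negP: nb; rewrite /good eqxx; apply/existsP; exists z.
    by rewrite zY dc1 leq_addr.
  have xl : (dist b a <= dist b x)%N.
    by rewrite leqNgt; apply/negP => /(noXc x xX) xb; rewrite xb eqxx in bx.
  have := vlt b bX bx; have := dc2; have := xl; rewrite !(dist_base b x) distxx.
  have := dist_lt b v; have := dist_lt b x.
  by clear; repeat (case: ifP); lia.
have := allgood x xX; rewrite /good eqxx => /existsP[w /andP[wY wv]]; exists w; split=> //.
have sub : X :\ x \subset Y.
  apply/subsetP => z; rewrite !inE => /andP[zx zX]; have := allgood z zX.
  by rewrite /good (negbTE zx).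
have wX : w \notin X :\ x.
  by rewrite !inE; apply/negP => /andP[wx wX]; have := vlt w wX wx; rewrite ltnNge wv.
apply/esym/eqP; rewrite eqEcard subUset sub1set wY sub /=.
by rewrite /move cardsU1 wX cY -cX (cardsD1 x X) xX.
Qed.

(** The properties of the set of d-arcs of a triangulation on which the quiver
    depends. *)
Definition arc_system (V : {set {set 'I_N}}) :=
  (forall X, X \in V -> #|X| = d.+1 /\ forall z, z \in X -> ordS z \notin X) /\
  (forall X Y, X \in V -> Y \in V -> ~ cross d X Y).

(** A shortest move inside a gap is an arrow: by [intermediate_move] a simplex
    preventing this would be a shorter move. *)
Lemma quiver_move V X x v : arc_system V -> X \in V -> x \in X -> gap X x v ->
  move X x v \in V ->
  (forall w, gap X x w -> move X x w \in V -> (dist x v <= dist x w)%N) ->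
  quiver_arrow d V X (move X x v).
Proof.
move=> [sV nV] XV xX gv DV vmin; have [cX sX] := sV X XV.
have vX := gap_notin (card_gt1 d_gt0 cX) xX gv.
split=> //.
- by apply: contraNneq vX => ->; rewrite in_move eqxx.
- by apply: move_intertwining => //; case: (sV _ DV).
move=> [Y [YV YX YD /(intertwining_cross d_gt0) c1 /(intertwining_cross d_gt0) c2]].
case: (intermediate_move xX gv c1 c2) => [/(nV _ _ XV YV)//|[w [YE wv]]].
have wx : w != x by apply: contraNneq YX => wx; rewrite YE wx /move setD1K.
have gw : gap X x w.
  apply/gapP => z zX zx; have /andP[_ vz] := gapP _ _ _ gv z zX zx.
  by rewrite /between dist_gt0 1?eq_sym // (leq_ltn_trans wv).
have := vmin w gw; rewrite -YE => /(_ YV) vw.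
have e : w = v by apply: (@dist_inj _ x); apply/eqP; rewrite eqn_leq wv vw.
by rewrite YE e eqxx in YD.
Qed.

Definition shifted M (f : 'I_N -> 'I_N) X := [set if a \in M then f a else a | a in X].

(** The invariant of a retrograde path from [X]: the elements that have moved
    are a run [M] of cyclically consecutive elements of [X], and the last one to
    move, [x], is the first of the run. *)
Definition retro_run X C A k := exists (M : {set 'I_N}) x f,
  [/\ M \subset X, #|M| = k, x \in M,
      C = shifted (M :\ x) f X /\ A = shifted M f X &
      (forall a, a \in M -> gap X a (f a)) /\
      (forall m z, m \in M -> z \in X -> z \notin M -> (dist x m < dist x z)%N)].

Lemma retro_run1 C A D p v y u : retro d C A D p v y u -> retro_run C C A 1.
Proof.
move=> [cC [pC vC vp pmin] [gy AE] [gu DE]].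
exists [set v], v, (fun=> y); split; rewrite ?sub1set ?cards1 ?inE //.
- split.
    apply/setP => z; apply/idP/imsetP => [zC|[a aC ->]]; last first.
      by rewrite !inE; case: (a == v).
    by exists z; rewrite // !inE; case: (z == v).
  apply/setP => z; rewrite AE in_move; apply/orP/imsetP.
    case=> [/eqP ->|/andP[zv zC]]; first by exists v; rewrite ?inE ?eqxx.
    by exists z; rewrite // inE (negbTE zv).
  move=> [a aC ->]; rewrite inE; have [_|av] := eqVneq a v; first by left.
  by right; rewrite av.
- split=> [a|m z]; rewrite !inE => /eqP -> //.
  by move=> zC zv; rewrite distxx dist_gt0 // eq_sym.
Qed.

(** The first element [x] of the run is the one that moved last, so that the
    next one to move is its predecessor in [C]. This cannot be an element that
    has moved, since an element of [X] outside the run would come between, so it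
    is an element of [X] that extends the run. *)
Lemma retro_runS X C A D p v y u k : #|X| = d.+1 -> (k <= d)%N ->
  retro_run X C A k -> retro d C A D p v y u -> retro_run X A D k.+1.
Proof.
move=> cX kd [M [x [f [MX cM xM [CE AE] [gf run]]]]] [cC [pC vC vp pmin] [gy AM] [gu DE]].
have fX a : a \in M -> f a \notin X.
  by move=> aM; apply: gap_notin (card_gt1 d_gt0 cX) _ (gf a aM); apply: (subsetP MX).
have xX := subsetP MX x xM.
have fixed z : z \in X -> z \notin M -> z \in C.
  move=> zX zM; rewrite CE; apply/imsetP; exists z => //.
  by rewrite !inE (negbTE zM) andbF.
have xC : x \in C by rewrite CE; apply/imsetP; exists x; rewrite // !inE eqxx.
(* The arrow from [C] to [A] determines which element it moves. *)
have xv : x = v.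
  apply/eqP/negPn/negP => xv; have : x \in A by rewrite AM in_move xv xC orbT.
  rewrite AE => /imsetP[a aX]; case: ifP => [aM e|aM e]; last by rewrite -e xM in aM.
  by have := fX a aM; rewrite -e xX.
subst v.
have /card_gt0P[z0] : (0 < #|X :\: M|)%N by rewrite cardsD (setIidPr MX) cX cM subn_gt0 ltnS.
rewrite inE => /andP[z0M z0X].
have [pX pM] : p \in X /\ p \notin M.
  move: pC; rewrite CE => /imsetP[a aX]; rewrite !inE.
  have [aM|aM] := boolP (a \in M); last by rewrite andbF => ->.
  have [->|ax] := eqVneq a x => /= pa; first by rewrite pa eqxx in vp.
  have z0a : z0 != a by apply: contraNneq z0M => ->.
  have z0p : z0 != p by apply: contraTneq z0X => ->; rewrite pa fX.
  have h1 := gapP _ _ _ (gf a aM) z0 z0X z0a; rewrite -pa in h1.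
  have xa : x != a by rewrite eq_sym.
  have h2 := gapP _ _ _ (gf a aM) x xX xa; rewrite -pa in h2.
  have h3 := run a z0 aM z0X z0M; have h4 := pmin z0 (fixed _ z0X z0M) z0p.
  exfalso; move: h1 h2 h3 h4 (dist_gt0 xa); rewrite /between !(dist_base x a) !(dist_base
    x p) distxx.
  have := dist_lt x a; have := dist_lt x p; have := dist_lt x z0.
  by clear; repeat (case: ifP); lia.
have px : p != x by apply: contraNneq pM => ->.
have pmax z : z \in X -> z != p -> (dist p x <= dist p z)%N.
  move=> zX zp; have [zM|zM] := boolP (z \in M); last exact: pmin (fixed _ zX zM) zp.
  have := run z p zM pX pM; rewrite !(dist_base x p) distxx.
  have := dist_lt x p; have := dist_lt x z; have xp : x != p by rewrite eq_sym.
  by have := dist_gt0 xp; clear; repeat (case: ifP); lia.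
exists (p |: M), p, (fun a => if a == p then u else f a); split.
- by rewrite subUset sub1set pX MX.
- by rewrite cardsU1 pM cM.
- by rewrite !inE eqxx.
- split.
    rewrite AE; apply: eq_in_imset => a aX; rewrite !inE.
    by have [->|//] := eqVneq a p; rewrite (negbTE pM).
  rewrite DE AE; apply/setP => z; rewrite in_move; apply/orP/imsetP.
    case=> [/eqP ->|/andP[zp /imsetP[a aX za]]].
      by exists p; rewrite // !inE !eqxx.
    exists a => //; rewrite !inE; have [ap|//] := eqVneq a p.
    by move: za zp; rewrite ap (negbTE pM) => ->; rewrite eqxx.
  move=> [a aX ->]; rewrite !inE; have [ap|ap] /= := eqVneq a p; first by left.
  right; apply/andP; split; last by apply/imsetP; exists a.
  by case: ifP => // aM; apply: contraTneq pX => <-; apply: fX.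
- split=> [a|m z]; rewrite !inE.
    have [->|ap /=] := eqVneq a p; last exact: gf.
    move=> _; apply/gapP => z zX zp; move/andP: gu => [u0 ux].
    by rewrite /between u0 (leq_trans ux) // pmax.
  move=> mM zX; rewrite negb_or => /andP[zp zM].
  have pz : p != z by rewrite eq_sym.
  move: mM => /orP[/eqP ->|mM]; first by rewrite distxx dist_gt0.
  have := run m z mM zX zM; have := run m p mM pX pM.
  have := pmax z zX zp; have := dist_gt0 pz; rewrite !(dist_base x p) distxx.
  have := dist_lt x p; have := dist_lt x z; have := dist_lt x m.
  have xp : x != p by rewrite eq_sym.
  by have := dist_gt0 xp; clear; repeat (case: ifP); lia.
Qed.

Lemma retro_run_cross X C A : #|X| = d.+1 -> retro_run X C A d.+1 -> cross d X A.
Proof.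
move=> cX [M [x [f [MX cM xM [CE AE] [gf run]]]]].
have ME : M = X by apply/eqP; rewrite eqEcard MX cX cM leqnn.
split=> //; exists f; last by move=> a; rewrite -{1}ME; apply: gf.
by rewrite AE ME; apply: eq_in_imset => a ->.
Qed.

Lemma retrograde_path_short V q : arc_system V -> retrograde_path d V q ->
  (size q < d.+2)%N.
Proof.
move=> [sV nV] [s2 arr ret]; rewrite ltnNge; apply/negP => sq.
have inV k : (k < size q)%N -> nth finset.set0 q k \in V.
  case: k => [|k] kq; last by case: (arr k kq).
  by case: (arr 0 s2).
have c0 : #|nth finset.set0 q 0| = d.+1 by apply: (sV _ _).1; apply: inV; apply: leq_trans sq.
have run k : (k <= d)%N ->
    retro_run (nth finset.set0 q 0) (nth finset.set0 q k) (nth finset.set0 q k.+1) k.+1.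
  elim: k => [_|k IH kd].
    have [|p [v [y [u h]]]] := (retrograde_atP d_gt0 _ _ _).1 (ret 0 _).
      by apply: leq_trans sq; rewrite ltnS.
    exact: retro_run1 h.
  have [|p [v [y [u h]]]] := (retrograde_atP d_gt0 _ _ _).1 (ret k _).
    by apply: leq_trans sq; rewrite !ltnS.
  exact: retro_runS (IH (ltnW kd)) h.
apply: (nV _ _ _ _ (retro_run_cross c0 (run d (leqnn _)))).
  by apply: inV; apply: leq_trans sq.
by apply: inV.
Qed.

Lemma maximal_extension V q : arc_system V -> retrograde_path d V q ->
  exists q', maximal_retrograde_path d V q' /\ infix q q'.
Proof.
move=> sV; have [m] := ubnP (d.+2 - size q); elim: m q => // m IH q hm rq.
have [[q' [rq' iq' sq']]|nmax] := pselect (exists q', [/\ retrograde_path d V q', infix q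
  q' & (size q < size q')%N]).
  have sh := retrograde_path_short sV rq'.
  have [|q'' [mq'' iq'']] := IH q' _ rq'.
    by move: hm sh sq'; clear; lia.
  by exists q''; split=> //; apply: infix_trans iq' iq''.
by exists q; split=> //; apply: infix_refl.
Qed.

Lemma middle_of_pair V C A D : arc_system V ->
  quiver_arrow d V C A -> quiver_arrow d V A D -> retrograde_at d C A D ->
  exists q, maximal_retrograde_path d V q /\ in_middle A q.
Proof.
move=> sV CA AD CAD; have [|q [mq /infixP[s1 [s2 qE]]]] := @maximal_extension V [:: C; A; D] sV.
  split=> // [[|[|k]]|[|k]] //.
exists q; split=> //; exists (size s1).+1; rewrite qE; split=> //.
  by rewrite !size_cat /=; lia.
by rewrite nth_cat ltnNge leqnSn /= subSn // subnn.
Qed.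

End Paths.

(** * Mutable arcs *)

Section Mutability.
Variables (R : realType) (N d : nat) (t : 'I_N -> R).
Hypothesis t_incr : forall i j : 'I_N, (i < j)%N -> t i < t j.
Hypothesis d_gt0 : (0 < d)%N.
Hypothesis N_gt : ((2 * d).+1 <= N)%N.
Implicit Types (a b p u v w x y z : 'I_N) (A B C D S X Y Z : {set 'I_N}).
Implicit Types (T : {set {set 'I_N}}).

Local Notation tri := (tri d t).
Local Notation V T := (d_arcs d t T).

Lemma d_arcs_system T : tri T -> arc_system d (V T).
Proof.
move=> triT; split=> [X|X Y].
  move=> /(d_arcsP t_incr d_gt0 N_gt)[cX _ /forall_inP sX]; by split.
move=> /(d_arcsP t_incr d_gt0 N_gt)[_ [S ST XS] _] /(d_arcsP t_incr d_gt0 N_gt)[_ [S' S'T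
  YS] _].
exact: noncrossing triT ST S'T XS YS.
Qed.

Lemma noncrossing_d_arc T D : tri T -> #|D| = d.+1 -> spread D ->
  (forall Z, Z \in V T -> ~ cross d D Z) -> D \in V T.
Proof.
move=> triT cD sD nD; apply/(d_arcsP t_incr d_gt0 N_gt).
case: (complete t_incr d_gt0 triT cD) => [[S ST DS]|[Z [S [ST ZS cDZ]]]].
  by split=> //; exists S.
by case: (nD Z _ cDZ); apply: (cross_d_arc t_incr d_gt0 (cross_sym d_gt0 cDZ) ST ZS).
Qed.

Lemma moveK X y v : y \in X -> v \notin X -> move (move X y v) v y = X.
Proof.
move=> yX vX; apply/setP => z; rewrite !in_move.
have [->|zy] /= := eqVneq z y; first by rewrite yX.
by have [->|zv] //= := eqVneq z v; rewrite (negbTE vX).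
Qed.

Lemma move_move X y v w : v \notin X -> move (move X y v) v w = move X y w.
Proof.
move=> vX; apply/setP => z; rewrite !in_move.
by have [->|zv] //= := eqVneq z v; rewrite (negbTE vX) andbF.
Qed.

(** Let [y] be the successor of [a]. The shortest move of [a] forward into the
    gap stops at [u] or before, and the shortest move of [y] backward stops at
    [u'] or after; reversing the second one gives the first arrow of the
    pair. *)
Lemma two_vertices_retro T A a u u' S S' : tri T -> A \in V T -> a \in A ->
  gap A a u -> gap A a u' -> S \in T -> S' \in T -> A \subset S -> A \subset S' ->
  u \in S -> u' \in S' -> (dist a u < dist a u')%N ->
  exists C D, [/\ quiver_arrow d (V T) C A, quiver_arrow d (V T) A D &
    retrograde_at d C A D].
Proof.
move=> triT AV aA gu gu' ST S'T AS AS' uS uS' uu'.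
have sysV := d_arcs_system triT; have [cA sA] := sysV.1 A AV.
have A1 := card_gt1 d_gt0 cA.
have N1 : (1 < N)%N by apply: leq_trans N_gt; rewrite ltnS muln_gt0.
have [y] := next_exists A1 aA; rewrite !inE => /andP[ya yA] ymin.
have gE w : gap A a w = between a y w := next_gap w yA ya ymin.
have gapA w : gap A a w -> w \notin A := gap_notin A1 aA.
have au : (0 < dist a u)%N by case/andP: (gapP _ _ _ gu y yA ya).
have uy : (dist a u' < dist a y)%N by case/andP: (gapP _ _ _ gu' y yA ya).
have ylt z : z \in A -> z != a -> z != y -> (dist a y < dist a z)%N.
  move=> zA za zy; rewrite ltn_neqAle ymin // andbT.
  by apply: contraNneq zy => /dist_inj ->.
have npred z w : (dist a z < dist a w)%N -> z != ord_pred a.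
  move=> zw; apply: contraTneq zw => ->; rewrite dist_pred_self -leqNgt.
  by have := dist_lt a w; clear; lia.
have subV X z w S1 : z \in A -> w \notin A -> S1 \in T -> A \subset S1 -> w \in S1 ->
    X = move A z w -> (forall x, x \in X -> ordS x \notin X) -> X \in V T.
  move=> zA wA S1T AS1 wS1 -> sX; apply/(d_arcsP t_incr d_gt0 N_gt); split.
  - by rewrite move_card.
  - by exists S1; rewrite // subUset sub1set wS1 (subset_trans _ AS1) // subD1set.
  - exact/forall_inP.
have DuV : move A a u \in V T.
  apply: (subV _ a u S) => //; first exact: gapA.
  move=> z; rewrite !in_move => /orP[/eqP ->|/andP[za zA]].
    rewrite negb_or ordS_neq //=; apply/negP => /andP[sa sAu].
    have := ymin _ sAu sa; rewrite dist_ordS ?(npred _ _ uu') //.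
    by move: uu' uy; clear; lia.
  rewrite negb_or (negbTE (sA z zA)) andbF andbT; apply/eqP => sz.
  have zp : z != ord_pred a.
    by apply: contraTneq au => zp; rewrite -sz zp ord_predK distxx.
  have := ymin z zA za; have := dist_ordS zp; rewrite sz.
  by move: uu' uy; clear; lia.
have CuV : move A y u' \in V T.
  apply: (subV _ y u' S') => //; first exact: gapA.
  move=> z; rewrite !in_move => /orP[/eqP ->|/andP[zy zA]].
    rewrite negb_or ordS_neq //=; apply/negP => /andP[sy sAu].
    have sE := dist_ordS (npred _ _ uy).
    have sa : ordS u' != a by apply/eqP => e; move: sE; rewrite e distxx.
    have := ylt _ sAu sa sy; rewrite sE.
    by move: uy; clear; lia.
  rewrite negb_or (negbTE (sA z zA)) andbF andbT; apply/eqP => sz.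
  have zp : z != ord_pred a.
    by apply: contraTneq (leq_trans au (ltnW uu')) => zp; rewrite -sz zp ord_predK distxx.
  have [za|za] := eqVneq z a.
    by have := dist_ordS zp; rewrite sz za distxx; move: au uu'; clear; lia.
  have := ylt z zA za zy; have := dist_ordS zp; rewrite sz.
  by move: uy; clear; lia.
pose P1 w := gap A a w && (move A a w \in V T).
pose P2 w := gap A a w && (move A y w \in V T).
have P1u : P1 u by rewrite /P1 gu.
have P2u : P2 u' by rewrite /P2 gu'.
have [v1 /andP[g1 V1] min1] := @arg_minnP _ u P1 (fun v => dist a v) P1u.
have [v2 /andP[g2 V2] min2] := @arg_minnP _ u' P2 (fun v => dist v y) P2u.
have v1u : (dist a v1 <= dist a u)%N := min1 u P1u.
have v2u : (dist v2 y <= dist u' y)%N := min2 u' P2u.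
have v2A := gapA v2 g2; have v1A := gapA v1 g1.
have /andP[a1 _] : between a y v1 by rewrite -gE.
have /andP[a2 v2y] : between a y v2 by rewrite -gE.
have uv2 : (dist a u' <= dist a v2)%N.
  move: v2u; rewrite !(dist_base a v2) !(dist_base a u'); move: v2y uy; clear.
  by repeat (case: ifP); lia.
have v1v2 : (dist a v1 < dist a v2)%N by move: v1u uu' uv2; clear; lia.
have v2C : v2 \in move A y v2 by rewrite in_move eqxx.
have aC : a \in move A y v2 by rewrite in_move aA [a == y]eq_sym ya orbT.
have cC : #|move A y v2| = d.+1 by rewrite move_card.
have gC w : (dist a v2 < dist a w)%N -> (dist a w <= dist a y)%N -> gap (move A y v2) v2 w.
  move=> lw wy; apply/gapP => z; rewrite in_move => /orP[/eqP ->|/andP[zy zA]]; first by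
    rewrite eqxx.
  move=> zv2; have [za|za] := eqVneq z a.
    rewrite za /between !(dist_base a v2) distxx; have := dist_lt a w; have := dist_lt a v2.
    by move: lw a2; clear; repeat (case: ifP); lia.
  have := ylt z zA za zy; rewrite /between !(dist_base a v2).
  have := dist_lt a z; move: lw wy; clear; by repeat (case: ifP); lia.
have moveC : move (move A y v2) v2 y = A := moveK yA v2A.
exists (move A y v2), (move A a v1); split.
- rewrite -{2}moveC; apply: quiver_move => //.
  + exact: gC.
  + by rewrite moveC.
  move=> w gw; rewrite move_move // => wV; rewrite leqNgt; apply/negP => wlt.
  have av2 : a != v2 by apply: contraNneq v2A => <-.
  have /andP[w0 wa] := gapP _ _ _ gw a aC av2.
  have [w1 w2] : (dist a v2 < dist a w)%N /\ (dist a w < dist a y)%N.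
    move: wlt w0 wa; rewrite !(dist_base a v2) distxx; move: v2y a2.
    have := dist_lt a w; have := dist_lt a y; have := dist_lt a v2.
    by clear; repeat (case: ifP); lia.
  have gaw : gap A a w by rewrite gE /between w2 (leq_trans a2 (ltnW w1)).
  have := min2 w; rewrite /P2 gaw wV => /(_ isT).
  rewrite !(dist_base a v2) !(dist_base a w); move: w1 w2 v2y; clear.
  by repeat (case: ifP); lia.
- apply: quiver_move => // w gw wV; by apply: min1; rewrite /P1 gw.
apply/(retrograde_atP d_gt0); exists a, v2, y, v1; split=> //; last first.
- by split=> //; rewrite /between a1.
- by rewrite moveC; split=> //; apply: gC.
split=> //; first by apply: contraNneq v2A => ->.
move=> z; rewrite in_move => /orP[/eqP ->//|/andP[zy zA]] za.
by apply: leq_trans (ltnW v2y) (ymin z zA za).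
Qed.

(** Consider the element of [B] between [p] and [y]. If it comes before [v], it
    still separates [p] from [v], and [B] crosses [C]; otherwise it comes after
    [u], and [B] crosses [D]. *)
Lemma retro_blocks C A D B p v y u : retro d C A D p v y u -> cross d A B ->
  cross d C B \/ cross d D B.
Proof.
move=> [cC [pC vC vp pmin] [gy AE] [gu DE]] [cA [f BE gf]].
have yC := gap_notin (card_gt1 d_gt0 cC) vC gy.
have yA : y \in A by rewrite AE in_move eqxx.
have pv : p != v by rewrite eq_sym.
have pA : p \in A by rewrite AE in_move pv pC orbT.
have yp : y != p by apply: contraNneq yC => ->.
have vA : v \notin A by rewrite AE in_move eqxx orbF; apply: contraNneq yC => <-.
have inA z : z \in A -> z != y -> z \in C /\ z != v.
  by rewrite AE in_move => /orP[/eqP ->|/andP[-> ->]] //; rewrite eqxx.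
have inC z : z \in C -> z != v -> z \in A.
  by move=> zC zv; rewrite AE in_move zv zC orbT.
have /andP[pvy yp'] := gapP _ _ _ gy p pC pv.
have [u0 uv] := andP gu; set b := f p.
have /andP[b0 by'] := gapP _ _ _ (gf p pA) y yA yp.
have vy : (dist p v < dist p y)%N.
  move: pvy yp'; rewrite !(dist_base p v) distxx; have := dist_lt p y; have := dist_lt p v.
  by have := dist_gt0 pv; clear; repeat (case: ifP); lia.
have yz z : z \in A -> z != p -> z != y -> (dist p y < dist p z)%N.
  move=> zA zp zy; have [zC zv] := inA z zA zy.
  have := gapP _ _ _ gy z zC zv; have := pmin z zC zp; move: vy.
  rewrite /between !(dist_base p v); have := dist_lt p z; clear.
  by repeat (case: ifP); lia.
have [bv|bv] := ltnP (dist p b) (dist p v); [left|right].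
  split=> //; exists (fun z => if z == v then f y else f z).
    rewrite BE AE; apply/setP => z; apply/imsetP/imsetP => -[w wI ->].
      move: wI; rewrite in_move => /orP[/eqP ->|/andP[wv wC]].
        by exists v => //; rewrite eqxx.
      by exists w => //; rewrite (negbTE wv).
    have [wv|wv] := eqVneq w v; first by exists y; rewrite // in_move eqxx.
    by exists w; rewrite // in_move wv wI orbT.
  move=> x xC; apply/gapP => z zC zx; have [xv|xv] := eqVneq x v.
    subst x; have zA := inC z zC zx; have zy : z != y by apply: contraNneq yC => <-.
    have := gapP _ _ _ (gf y yA) z zA zy; have := gapP _ _ _ gy z zC zx.
    rewrite /between !(dist_base v y); have := dist_lt v z; have := dist_lt v (f y); clear.
    by repeat (case: ifP); lia.
  have xA := inC x xC xv; have xy : x != y by apply: contraNneq yC => <-.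
  have [zv|zv] := eqVneq z v; last first.
    by apply: (gapP _ _ _ (gf x xA)) => //; apply: inC.
  subst z; have [xp|xp] := eqVneq x p; first by rewrite xp /between b0.
  have px : p != x by rewrite eq_sym.
  have := gapP _ _ _ (gf x xA) p pA px; have := pmin x xC xp; have := dist_gt0 px.
  rewrite /between !(dist_base p x) distxx; have := dist_lt p (f x); have := dist_lt p x.
  have : dist p v != dist p x by apply: contraNneq xv => /dist_inj ->.
  by have := dist_gt0 pv; clear; repeat (case: ifP); lia.
have uA : u \notin A.
  apply/negP => uA; have up : u != p by apply: contraTneq u0 => ->; rewrite distxx.
  have uy : u != y by apply: contraTneq uv => ->; rewrite -leqNgt ltnW.
  by have := yz u uA up uy; move: uv vy; clear; lia.
have fu z : z \in A -> z != u by move=> zA; apply: contraNneq uA => <-.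
split; first by rewrite DE move_card.
exists (fun z => if z == u then b else f z).
  rewrite BE DE; apply/setP => z; apply/imsetP/imsetP => -[w wI ->].
    have [->|wp] := eqVneq w p; first by exists u; rewrite ?in_move ?eqxx.
    by exists w; rewrite ?in_move ?wp ?wI ?orbT // (negbTE (fu w wI)).
  move: wI; rewrite in_move => /orP[/eqP ->|/andP[wv wC]]; first by exists p; rewrite // eqxx.
  by exists w; rewrite // (negbTE (fu w wC)).
move=> x; rewrite DE in_move => /orP[/eqP ->|/andP[xp xA]]; apply/gapP => z; rewrite in_move.
  rewrite eqxx => /orP[/eqP ->|/andP[zp zA]]; first by rewrite eqxx.
  move=> zu; have := gapP _ _ _ (gf p pA) z zA zp; rewrite -/b.
  rewrite /between !(dist_base p u); have := dist_lt p z; move: uv bv u0; clear.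
  by repeat (case: ifP); lia.
rewrite (negbTE (fu x xA)) => /orP[/eqP -> ux|/andP[zp zA] zx]; last exact: gapP (gf x
  xA) _ zA zx.
have px : p != x by rewrite eq_sym.
have xu : (dist p u < dist p x)%N.
  have [->|xy] := eqVneq x y; first exact: ltn_trans uv vy.
  by have := yz x xA xp xy; move: uv vy; clear; lia.
have := gapP _ _ _ (gf x xA) p pA px.
rewrite /between !(dist_base p x) distxx; have := dist_lt p (f x); have := dist_lt p x.
by move: xu u0; clear; repeat (case: ifP); lia.
Qed.

(** A face of a simplex on [A :|: B] is a face of one opposite to [B] unless it
    is [B], and of one opposite to [A] unless it is [A]. *)
Lemma flip_d_arcs T A B : tri T -> cross d A B ->
  (forall b, b \in B -> (A :|: B) :\ b \in T) ->
  A \in V T -> B \in V (flip T A B) /\ V T :\ A = V (flip T A B) :\ B.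
Proof.
move=> triT cAB TB AV; have triT' := flip_tri t_incr d_gt0 cAB triT TB.
have cBA := cross_sym d_gt0 cAB; have [cA cB] := cross_card cAB.
have newS a : a \in A -> (A :|: B) :\ a \in flip T A B.
  by move=> aA; rewrite inE; apply/orP; right; apply/imsetP; exists a.
have AB := cross_disj d_gt0 cAB; have BA := cross_disj d_gt0 cBA.
have missing X D : #|X| = d.+1 -> #|D| = d.+1 -> D != X -> exists2 x, x \in X & x \notin D.
  move=> cX cD DX; apply/exists_inP; rewrite -[[exists _ in _, _]]negbK.
  apply/negP => /exists_inPn h; case/negP: DX; rewrite eq_sym eqEcard cX cD leqnn andbT.
  by apply/subsetP => x /h; rewrite negbK.
have BV : B \in V (flip T A B).
  have /card_gt0P[a aA] : (0 < #|A|)%N by rewrite cA.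
  apply: (cross_d_arc t_incr d_gt0 cBA (newS a aA)).
  by rewrite subsetD1 subsetUr AB.
split=> //; have [_ nV] := d_arcs_system triT; have [_ nV'] := d_arcs_system triT'.
apply/setP => D; rewrite !in_setD1; apply/andP/andP => -[ne DV].
  have nB : D != B by apply/eqP => DB; apply: (nV _ _ AV DV); rewrite DB.
  split=> //; move: DV => /(d_arcsP t_incr d_gt0 N_gt)[cD [S ST DS] sD].
  apply/(d_arcsP t_incr d_gt0 N_gt); split=> //.
  have [SU|SU] := boolP (S \subset A :|: B); last by exists S; rewrite // !inE ST SU.
  have [a aA aD] := missing A D cA cD ne; exists ((A :|: B) :\ a); first exact: newS.
  by rewrite subsetD1 (subset_trans DS SU) aD.
have nA : D != A by apply/eqP => DA; apply: (nV' _ _ BV DV); rewrite DA.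
split=> //; move: DV => /(d_arcsP t_incr d_gt0 N_gt)[cD [S ST DS] sD].
apply/(d_arcsP t_incr d_gt0 N_gt); split=> //.
move: ST; rewrite inE => /orP[|/imsetP[a aA SE]]; first by rewrite inE => /andP[ST _]; exists S.
have [b bB bD] := missing B D cB cD ne; exists ((A :|: B) :\ b); first exact: TB.
by rewrite subsetD1 bD andbT (subset_trans DS) // SE subD1set.
Qed.

Lemma flip_mutable T A B : tri T -> cross d A B ->
  (forall b, b \in B -> (A :|: B) :\ b \in T) -> A \in V T -> mutable d t T A.
Proof.
move=> triT cAB TB AV; have triT' := flip_tri t_incr d_gt0 cAB triT TB.
have [BV' VE] := flip_d_arcs triT cAB TB AV.
have [_ nV] := d_arcs_system triT; have [_ nV'] := d_arcs_system triT'.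
have BV : B \notin V T by apply/negP => BV; exact: nV AV BV cAB.
have AV' : A \notin V (flip T A B) by apply/negP => AV'; exact: nV' AV' BV' cAB.
have BA : B != A by apply: contraNneq BV => ->.
have VD D : D != A -> D != B -> (D \in V T) = (D \in V (flip T A B)).
  by move=> DA DB; have := congr1 (fun W : {set {set 'I_N}} => D \in W) VE; rewrite
    !in_setD1 DA DB.
exists (flip T A B), B; split=> //; split.
- exact/(triangulation_tri d t_incr _).
- exact/(triangulation_tri d t_incr _).
- rewrite (_ : _ :\: _ = [set A]) ?cards1 //; apply/setP => D; rewrite in_setD in_set1.
  have [->|DA] := eqVneq D A; first by rewrite AV AV'.
  by have [->|DB] := eqVneq D B; [rewrite BV' | rewrite VD // andNb].
- rewrite (_ : _ :\: _ = [set B]) ?cards1 //; apply/setP => D; rewrite in_setD in_set1.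
  have [->|DB] := eqVneq D B; first by rewrite BV BV'.
  by have [->|DA] := eqVneq D A; [rewrite AV | rewrite VD // andNb].
Qed.

Lemma mutable_not_middle T A q : tri T -> mutable d t T A ->
  retrograde_path d (V T) q -> ~ in_middle A q.
Proof.
move=> triT [T' [B [[_ /(triangulation_tri d t_incr _) triT' _ _] BV' BA VE]]].
move=> [s2 arr ret] [[|k] [k0 kq] Ak] //.
have [CV AV CA _ _] := arr k (ltnW kq); have [_ DV AD _ _] := arr k.+1 kq.
have CAD := ret k kq; rewrite Ak in CA AV AD CAD.
have [p [v [y [u rCAD]]]] := (retrograde_atP d_gt0 _ _ _).1 CAD.
have inV' E : E \in V T -> E != A -> E \in V T'.
  move=> EV EA; have : E \in V T' :\ B by rewrite -VE in_setD1 EA.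
  by rewrite in_setD1 => /andP[].
have [_ nV'] := d_arcs_system triT'.
have BV : B \notin V T.
  apply/negP => BV; have : B \in V T' :\ B by rewrite -VE in_setD1 BA.
  by rewrite in_setD1 eqxx.
have cAB : cross d A B.
  move: BV' => BV'; have /(d_arcsP t_incr d_gt0 N_gt)[cB _ sB] := BV'.
  have [h|nc] := pselect (exists2 Z, Z \in V T & cross d B Z).
    case: h => Z ZV cBZ; have [ZA|ZA] := eqVneq Z A.
      by apply: cross_sym => //; rewrite -ZA.
    by case: (nV' _ _ BV' (inV' Z ZV ZA) cBZ).
  case/negP: BV; apply: noncrossing_d_arc => // Z ZV cBZ.
  by apply: nc; exists Z.
have [cCB|cDB] := retro_blocks rCAD cAB.
  exact: nV' (inV' _ CV CA) BV' cCB.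
by apply: nV' (inV' _ DV _) BV' cDB; rewrite eq_sym.
Qed.

Lemma not_middle_mutable T A : tri T -> A \in V T ->
  ~ (exists q, maximal_retrograde_path d (V T) q /\ in_middle A q) -> mutable d t T A.
Proof.
move=> triT AV nq; have sysV := d_arcs_system triT.
have /(d_arcsP t_incr d_gt0 N_gt)[cA [S0 S0T AS0] sA] := AV.
have gapA a : a \in A -> exists z, gap A a z.
  move=> aA; have [_ [f _ fP]] := spread_cross d_gt0 N_gt cA sA.
  by exists (f a); apply: fP.
have far a u u' S S' : a \in A -> gap A a u -> gap A a u' -> S \in T -> S' \in T ->
    A \subset S -> A \subset S' -> u \in S -> u' \in S' -> ~~ (dist a u < dist a u')%N.
  move=> aA gu gu' ST S'T AS AS' uS uS'; apply/negP => uu'; apply: nq.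
  have [C [D [CA AD CAD]]] := two_vertices_retro triT AV aA gu gu' ST S'T AS AS' uS uS' uu'.
  exact: middle_of_pair sysV CA AD CAD.
have [|B cAB TB] := single_vertices_flip t_incr d_gt0 triT S0T AS0 cA gapA.
  move=> a u u' S S' aA gu gu' ST S'T AS AS' uS uS'.
  have h1 := far a u u' S S' aA gu gu' ST S'T AS AS' uS uS'.
  have h2 := far a u' u S' S aA gu' gu S'T ST AS' AS uS' uS.
  apply: (@dist_inj _ a); apply/eqP; rewrite eqn_leq leqNgt h2.
  by rewrite leqNgt h1.
exact: flip_mutable triT cAB TB AV.
Qed.

End Mutability.

Theorem theoremB (R : realType) (d n : nat) (hd : (1 <= d)%N)
    (t : 'I_(n + 2 * d + 1) -> R)
    (ht : forall i j : 'I_(n + 2 * d + 1), (i < j)%N -> (t i < t j)%R)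
    (T : {set {set 'I_(n + 2 * d + 1)}}) (hT : triangulation d t T)
    (A : {set 'I_(n + 2 * d + 1)}) (hA : A \in d_arcs d t T) :
  mutable d t T A <->
  ~ exists p : seq {set 'I_(n + 2 * d + 1)},
      maximal_retrograde_path d (d_arcs d t T) p /\ in_middle A p.
Proof.
have N_gt : ((2 * d).+1 <= n + 2 * d + 1)%N by rewrite addn1 ltnS leq_addl.
have triT := (triangulation_tri d ht T).1 hT.
split=> [mA [q [[rq _] mq]]|]; first exact: mutable_not_middle mA rq mq.
exact: not_middle_mutable.
Qed.
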